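(* Let $\theta\in(0,1]$, $\Delta t>0$. Suppose that the mesh $\mathcal{T}_h$ satisfies the anisotropic nonobtuse angle condition $$0<\widetilde{\alpha}_{ij}^K\le\frac{\pi}{2},\qquad \forall\, i,j=1,\dots,d+1,\ i\ne j,\ \forall K\in\mathcal{T}_h,$$ and that the time step size satisfies $$\frac{1}{\theta(d+1)(d+2)}\max_{K\in\mathcal{T}_h}\ \max_{\substack{i,j=1,\dots,d+1\\ i\ne j}}\frac{h_i^Kh_j^K}{\cos(\widetilde{\alpha}_{ij}^K)\,\lambda_{\min}(\mathbb{D}_K)}\ \le\ \Delta t\ \le\ \frac{2}{(1-\theta)(d+1)(d+2)}\min_{K\in\mathcal{T}_h}\ \min_{i=1,\dots,d+1}\frac{(h_i^K)^2}{\lambda_{\max}(\mathbb{D}_K)}.$$ Then the scheme $$B\,\boldsymbol{u}^{n+1}=C\,\boldsymbol{u}^n+\Delta t\,\boldsymbol{f}^{n+\theta},\quad n=0,\dots,N-1,\qquad \boldsymbol{u}^0=(u_0(\boldsymbol{a}_1),\dots,u_0(\boldsymbol{a}_{N_v}))^T,$$ satisfies a discrete maximum principle: whenever $f(\boldsymbol{x},t)\le 0$ in $\Omega_T$, its solution satisfies $$\max_{n=0,\dots,N}\ \max_{\boldsymbol{x}\in\overline{\Omega}}U^n(\boldsymbol{x})\ =\ \max\Big\{0,\ \max_{n=1,\dots,N}\ \max_{\boldsymbol{x}\in\partial\Omega}U^n(\boldsymbol{x}),\ \max_{\boldsymbol{x}\in\overline{\Omega}}U^0(\boldsymbol{x})\Big\},$$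 where $U^n(\boldsymbol{x})=\sum_{j=1}^{N_v}u_j^n\phi_j(\boldsymbol{x})$.
   Context: Problem. $\Omega\subset\mathbb{R}^d$ ($d\ge1$) is a connected polygonal or polyhedral domain, $T>0$, $\Omega_T=\Omega\times(0,T]$. The problem being discretized is $u_t-\nabla\cdot(\mathbb{D}\nabla u)=f(\boldsymbol{x},t)$ in $\Omega_T$, $u=g(\boldsymbol{x},t)$ on $\partial\Omega\times[0,T]$, $u(\boldsymbol{x},0)=u_0(\boldsymbol{x})$ in $\Omega$, with given functions $f,g,u_0$ and a symmetric, strictly positive definite matrix-valued function $\mathbb{D}=\mathbb{D}(\boldsymbol{x})$ independent of time. Data are assumed regular enough that the integrals and point values below make sense. Mesh. $\mathcal{T}_h$ is a (conforming) simplicial triangulation of $\Omega$ with vertices $\boldsymbol{a}_1,\dots,\boldsymbol{a}_{N_v}$, ordered so that the first $N_{vi}$ are the interior vertices (the others lie on $\partial\Omega$). $\phi_j$ is the continuous piecewise linear basis function associated with $\boldsymbol{a}_j$. $|K|$ is the volume of $K$ and $\mathbb{D}_K=\frac1{|K|}\int_K\mathbb{D}\,d\boldsymbol{x}$; $\lambda_{\min}(\mathbb{D}_K),\lambda_{\max}(\mathbb{D}_K)$ are its smallest and largest eigenvalues. Geometry. For $K\in\mathcal{T}_h$ with vertices $\boldsymbol{a}_1^K,\dots,\boldsymbol{a}_{d+1}^K$, $S_i^K$ is the face opposite $\boldsymbol{a}_i^K$, $\boldsymbol{n}_i^K$ its unit normal pointing to $\boldsymbol{a}_i^K$, $h_i^K$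 the distance from $\boldsymbol{a}_i^K$ to $S_i^K$, and $\boldsymbol{q}_i^K=\boldsymbol{n}_i^K/h_i^K$. For $i\ne j$, $\widetilde\alpha_{ij}^K\in[0,\pi]$ is the dihedral angle between the faces $\mathbb{D}_K^{-1/2}S_i^K$ and $\mathbb{D}_K^{-1/2}S_j^K$ of $\mathbb{D}_K^{-1/2}K$ (i.e. the angle of $K$ in the metric $\mathbb{D}_K^{-1}$), given by $$\cos(\widetilde\alpha_{ij}^K)=-\frac{(\boldsymbol{q}_i^K)^T\mathbb{D}_K\boldsymbol{q}_j^K}{\|\boldsymbol{q}_i^K\|_{\mathbb{D}_K}\|\boldsymbol{q}_j^K\|_{\mathbb{D}_K}},\qquad \|\boldsymbol{q}\|_{\mathbb{D}_K}=\sqrt{\boldsymbol{q}^T\mathbb{D}_K\boldsymbol{q}}.$$ Scheme ($\theta$-method in time, linear finite elements in space). For $i=1,\dots,N_{vi}$, $j=1,\dots,N_v$ let $$m_{ij}=\sum_{K\in\mathcal{T}_h}\int_K\phi_j\phi_i\,d\boldsymbol{x},\qquad a_{ij}=\sum_{K\in\mathcal{T}_h}|K|(\nabla\phi_i|_K)^T\mathbb{D}_K\nabla\phi_j|_K,$$ $f_i(t)=\sum_{K}\int_K f(\boldsymbol{x},t)\phi_i\,d\boldsymbol{x}$; $[M_{11}\ M_{12}]=(m_{ij})$ and $[A_{11}\ A_{12}]=(a_{ij})$, partitioned by columns $1,\dots,N_{vi}$ and $N_{vi}+1,\dots,N_v$. Then $$B=\begin{bmatrix}M_{11}&M_{12}\\0&I\end{bmatrix}+\theta\Delta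 t\begin{bmatrix}A_{11}&A_{12}\\0&0\end{bmatrix},\qquad C=\begin{bmatrix}M_{11}&M_{12}\\0&0\end{bmatrix}-(1-\theta)\Delta t\begin{bmatrix}A_{11}&A_{12}\\0&0\end{bmatrix},$$ $$\boldsymbol{f}^{n+\theta}=\Big(f_1(t_n+\theta\Delta t),\dots,f_{N_{vi}}(t_n+\theta\Delta t),\tfrac1{\Delta t}g(\boldsymbol{a}_{N_{vi}+1},t_{n+1}),\dots,\tfrac1{\Delta t}g(\boldsymbol{a}_{N_v},t_{n+1})\Big)^T,$$ where $I$ is the identity matrix of size $N_v-N_{vi}$, $t_n=n\Delta t$, $N\ge1$ is the number of time steps, $N\Delta t\le T$, and $\boldsymbol{u}^n=(u_1^n,\dots,u_{N_v}^n)^T$. Conventions. A quotient with positive numerator and zero denominator is $+\infty$: the lower bound cannot be met if some $\cos(\widetilde\alpha_{ij}^K)=0$, and the upper bound is no constraint when $\theta=1$.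
   Formalization: The printed equality fails when all values are negative (f=0, g=u_0=-1 gives -1 on the left, 0 on the right); what is proved is left side ≤ right side, with equality whenever the left side is ≥ 0. h_i^K is read as the altitude, and Ω as the interior of its closure. *)

(* Defs.v *)
From HB Require Import structures.
From mathcomp Require Import all_boot all_order all_algebra.
From mathcomp Require Import all_classical all_reals all_analysis.

Set Implicit Arguments.
Unset Strict Implicit.
Unset Printing Implicit Defensive.

Import Order.TTheory GRing.Theory Num.Theory.
Import numFieldNormedType.Exports.

Local Open Scope classical_set_scope.
Local Open Scope ring_scope.

Section lebesgue_tuple.
Context {R : realType}.
Local Notation T := (measurableTypeR R).

Definition tuple_cons n (p : T * n.-tuple T) : n.+1.-tuple T :=
  [the n.+1.-tuple T of p.1 :: p.2].

Lemma measurable_tuple_cons n :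
  measurable_fun [set: T * n.-tuple T] (@tuple_cons n).
Proof. exact: measurable_cons. Qed.

Section step.
Variables (n : nat) (mu : {sigma_finite_measure set (n.-tuple T) -> \bar R}).

Definition leb_cons : set (n.+1.-tuple T) -> \bar R :=
  pushforward (lebesgue_measure \x mu)%E (@tuple_cons n).

Let measurable_preimage A :
  measurable A -> measurable (@tuple_cons n @^-1` A).
Proof.
by move=> mA; rewrite -[X in measurable X]setTI; exact: measurable_tuple_cons.
Qed.

Let leb_cons0 : leb_cons set0 = 0%E.
Proof. by rewrite /leb_cons /pushforward preimage_set0 measure0. Qed.

Let leb_cons_ge0 A : (0 <= leb_cons A)%E.
Proof. by rewrite /leb_cons /pushforward measure_ge0. Qed.

Let leb_cons_sigma_additive : semi_sigma_additive leb_cons.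
Proof.
move=> F mF tF mUF; rewrite /leb_cons /pushforward preimage_bigcup.
apply: measure_semi_sigma_additive.
- by move=> k; exact: measurable_preimage.
- apply/trivIsetP => /= i j _ _ ij; rewrite -preimage_setI.
  by move/trivIsetP : tF => /(_ _ _ _ _ ij) ->//; rewrite preimage_set0.
- by rewrite -preimage_bigcup; exact: measurable_preimage.
Qed.

HB.instance Definition _ := isMeasure.Build _ _ _
  leb_cons leb_cons0 leb_cons_ge0 leb_cons_sigma_additive.

Let leb_cons_sigma_finite : sigma_finite setT leb_cons.
Proof.
have /sigma_finiteP[F [TF ndF Foo]] := sigma_finiteT (@lebesgue_measure R).
have /sigma_finiteP[G [TG ndG Goo]] := sigma_finiteT mu.
pose split (t : n.+1.-tuple T) : T * n.-tuple T := (thead t, behead_tuple t).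
have splitK p : split (tuple_cons p) = p.
  by case: p => x t; rewrite /split /tuple_cons; congr pair; exact/val_inj.
exists (fun k => split @^-1` (F k `*` G k)).
  apply/seteqP; split => // t _.
  have [k _ Fk] : (\bigcup_k F k) (thead t) by rewrite -TF.
  have [l _ Gl] : (\bigcup_k G k) (behead_tuple t) by rewrite -TG.
  exists (maxn k l) => //; split.
    by move: Fk; exact/subsetPset/ndF/leq_maxl.
  by move: Gl; exact/subsetPset/ndG/leq_maxr.
move=> k; have [mF Fk] := Foo k; have [mG Gk] := Goo k; split.
  rewrite -[X in measurable X]setTI.
  suff : measurable_fun [set: n.+1.-tuple T] split.
    by apply => //; exact: measurableX.
  apply/measurable_fun_pairP; split => /=.
    exact: measurable_tnth.
  exact: measurable_behead.
rewrite /leb_cons /pushforward -comp_preimage.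
rewrite (_ : _ @^-1` _ = F k `*` G k).
  by rewrite product_measure1E// lte_mul_pinfty// ge0_fin_numE.
by rewrite (_ : split \o _ = id)//; apply/funext => p; exact: splitK.
Qed.

HB.instance Definition _ := Measure_isSigmaFinite.Build _ _ _
  leb_cons leb_cons_sigma_finite.

End step.

(* The product of n copies of the one-dimensional Lebesgue measure, on the
   product sigma-algebra of n-tuples (the Borel sigma-algebra of R^n). *)
Fixpoint leb n : {sigma_finite_measure set (n.-tuple T) -> \bar R} :=
  match n with
  | 0%N => \d_([tuple] : 0.-tuple T)
  | m.+1 => leb_cons (leb m)
  end.

End lebesgue_tuple.

Section euclidean_space.
Context {R : realType} {d : nat}.
Local Notation point := 'rV[R]_d.
Implicit Types (u v x : point) (A : set point) (M : 'M[R]_d).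

(* The library norm on matrices is the sup norm, hence these definitions. *)
Definition dotv u v : R := \sum_(k < d) u 0 k * v 0 k.

Definition enorm u : R := Num.sqrt (dotv u u).

Definition bform M u v : R := (u *m M *m v^T) 0 0.

Definition dnorm M u : R := Num.sqrt (bform M u u).

Definition eig_min M : R := inf [set r | eigenvalue M r].

Definition eig_max M : R := sup [set r | eigenvalue M r].

Definition boundary A : set point := closure A `\` A°.

Definition grad (phi : point -> R) x : point :=
  \row_(k < d) 'D_(delta_mx 0 k) phi x.

Definition point_of (t : d.-tuple (measurableTypeR R)) : point :=
  \row_(k < d) tnth t k.

Definition volume A : R := fine (leb d (point_of @^-1` A)).

Definition integral_on A (F : point -> R) : R :=
  \int[leb d]_(t in point_of @^-1` A) F (point_of t).

Definition integrable_on A (F : point -> R) : Prop :=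
  (leb d).-integrable (point_of @^-1` A) (fun t => (F (point_of t))%:E).

Section hulls.
Context {n : nat} (a : 'I_n -> point).
Implicit Type K : {set 'I_n}.

Definition conv_hull K : set point :=
  [set x | exists c : 'I_n -> R, [/\ forall i, i \in K -> 0 <= c i,
     \sum_(i in K) c i = 1 & x = \sum_(i in K) c i *: a i]].

Definition affine_hull K : set point :=
  [set x | exists c : 'I_n -> R,
     \sum_(i in K) c i = 1 /\ x = \sum_(i in K) c i *: a i].

Definition affinely_independent K : Prop :=
  forall c : 'I_n -> R, \sum_(i in K) c i = 0 ->
    \sum_(i in K) c i *: a i = 0 -> forall i, i \in K -> c i = 0.

Definition barycenter K : point := (#|K|%:R)^-1 *: \sum_(i in K) a i.

End hulls.

(* The fourth clause makes Omega lie on one side of its boundary (no cracks or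
   punctures), as is implicit in triangulating closure Omega conformingly. *)
Definition polyhedral_domain (Omega : set point) : Prop :=
  [/\ open Omega, Omega !=set0, connected Omega, (closure Omega)° = Omega &
      exists (n : nat) (a : 'I_n -> point) (P : {set {set 'I_n}}),
        closure Omega = \bigcup_(K in [set` P]) conv_hull a K].

End euclidean_space.

(* A cell is the set of the indices of its vertices; the interior vertices
   come first, and the numbers of interior and of boundary vertices are fields
   so that the matrices of the scheme are honest block matrices. A local index
   i = 1, ..., d+1 of the cell K is here an index i \in K. *)
Record mesh (R : realType) (d : nat) := Mesh {
  nint : nat ;
  nbnd : nat ;
  vertex : 'I_(nint + nbnd) -> 'rV[R]_d ;
  cells : {set {set 'I_(nint + nbnd)}}
}.

Section mesh.
Context {R : realType} {d : nat} (Th : mesh R d).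
Local Notation point := 'rV[R]_d.
Local Notation nvtx := (nint Th + nbnd Th)%N.
Local Notation a := (@vertex _ _ Th).
Implicit Types (Omega : set point) (K L : {set 'I_nvtx}) (i j : 'I_nvtx).

Definition cell K : set point := conv_hull a K.

Definition triangulation_of Omega : Prop :=
  [/\ forall K, K \in cells Th -> #|K| = d.+1 /\ affinely_independent a K,
      closure Omega = \bigcup_(K in [set` cells Th]) cell K,
      forall K L, K \in cells Th -> L \in cells Th ->
        cell K `&` cell L = cell (K :&: L),
      injective a /\ (forall i, exists2 K, K \in cells Th & i \in K) &
      (forall i : 'I_(nint Th), Omega (a (lshift (nbnd Th) i))) /\
      (forall j : 'I_(nbnd Th), boundary Omega (a (rshift (nint Th) j)))].

Definition face_normal K i : point :=
  xget 0 [set v | [/\ enorm v = 1,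
    forall j k, j \in K :\ i -> k \in K :\ i -> dotv v (a j - a k) = 0 &
    forall j, j \in K :\ i -> 0 < dotv v (a i - a j)]].

(* Distance to the hyperplane carrying the face opposite to the vertex i (the
   altitude), as required by grad phi_i = q_i; for an obtuse simplex it may be
   smaller than the distance to the face itself. *)
Definition height K i : R :=
  inf [set enorm (a i - y) | y in affine_hull a (K :\ i)].

Definition qvec K i : point := (height K i)^-1 *: face_normal K i.

Definition mean_mx (D : point -> 'M[R]_d) K : 'M[R]_d :=
  (volume (cell K))^-1 *:
    \matrix_(k < d, l < d) integral_on (cell K) (fun x => D x k l).

Definition metric_angle (D : point -> 'M[R]_d) K i j : R :=
  let M := mean_mx D K in
  acos (- (bform M (qvec K i) (qvec K j) /
           (dnorm M (qvec K i) * dnorm M (qvec K j)))).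

(* The extended-real inverse of 0 is +oo, so that a vanishing cosine makes the
   lower bound +oo, and theta = 1 makes the upper bound +oo. *)
Definition time_step_lower (D : point -> 'M[R]_d) (theta : R) : \bar R :=
  (1%:E / (theta * d.+1%:R * d.+2%:R)%:E *
   \big[maxe/-oo]_(K in cells Th)
     \big[maxe/-oo]_(i in K) \big[maxe/-oo]_(j in K | j != i)
       ((height K i * height K j)%:E /
        (cos (metric_angle D K i j) * eig_min (mean_mx D K))%:E))%E.

Definition time_step_upper (D : point -> 'M[R]_d) (theta : R) : \bar R :=
  (2%:E / ((1 - theta) * d.+1%:R * d.+2%:R)%:E *
   \big[mine/+oo]_(K in cells Th)
     \big[mine/+oo]_(i in K)
       ((height K i ^+ 2)%:E / (eig_max (mean_mx D K))%:E))%E.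

Definition nodal_basis Omega (phi : 'I_nvtx -> point -> R) : Prop :=
  forall j,
  [/\ {within closure Omega, continuous (phi j)},
      forall K, K \in cells Th -> exists (c : R) (v : point),
        forall x, cell K x -> phi j x = c + dotv v x &
      forall i, phi j (a i) = (i == j)%:R].

Section scheme.
Variables (phi : 'I_nvtx -> point -> R) (D : point -> 'M[R]_d).
Variables (f g : point -> R -> R) (theta dt : R).

(* phi_i is affine on K: its gradient there may be taken at the barycenter. *)
Definition cell_grad K i : point := grad (phi i) (barycenter a K).

Definition mass_mx : 'M[R]_(nint Th, nvtx) := \matrix_(i, j)
  \sum_(K in cells Th)
    integral_on (cell K) (fun x => phi j x * phi (lshift _ i) x).

Definition stiff_mx : 'M[R]_(nint Th, nvtx) := \matrix_(i, j)
  \sum_(K in cells Th) volume (cell K) *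
    bform (mean_mx D K) (cell_grad K (lshift _ i)) (cell_grad K j).

Definition load (i : 'I_(nint Th)) (t : R) : R :=
  \sum_(K in cells Th)
    integral_on (cell K) (fun x => f x t * phi (lshift _ i) x).

Definition Bmx : 'M[R]_nvtx :=
  block_mx (lsubmx mass_mx) (rsubmx mass_mx) 0 1%:M +
  (theta * dt) *: block_mx (lsubmx stiff_mx) (rsubmx stiff_mx) 0 0.

Definition Cmx : 'M[R]_nvtx :=
  block_mx (lsubmx mass_mx) (rsubmx mass_mx) 0 0 -
  ((1 - theta) * dt) *: block_mx (lsubmx stiff_mx) (rsubmx stiff_mx) 0 0.

Definition rhs (n : nat) : 'cV[R]_nvtx :=
  col_mx (\col_i load i (n%:R * dt + theta * dt))
         (\col_j (dt^-1 * g (a (rshift _ j)) (n.+1%:R * dt))).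

Definition scheme_solution (u0 : point -> R) (N : nat)
    (u : nat -> 'cV[R]_nvtx) : Prop :=
  u 0%N = \col_j u0 (a j) /\
  forall n, (n < N)%N -> Bmx *m u n.+1 = Cmx *m u n + dt *: rhs n.

Definition fe_fun (v : 'cV[R]_nvtx) (x : point) : R :=
  \sum_(j < nvtx) v j 0 * phi j x.

(* Used with a nonempty finite set S of time levels and a nonempty compact X,
   where the supremum is a maximum. *)
Definition fe_max (u : nat -> 'cV[R]_nvtx) (S : set nat) (X : set point) : R :=
  sup [set fe_fun (u p.1) p.2 | p in S `*` X].

End scheme.
End mesh.

(* Main.v *)
(* Idea.  On a cell K the basis functions are the barycentric coordinates l_i of
   K, with gradients q_i.  The element mass matrix has entries
   (1 + delta_ij) |K| / ((d+1)(d+2)).  Up to |K| the element stiffness matrix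
   has entries q_i D_K q_j, at most lmax / h_i^2 when i = j, and at most
   - cos(alpha_ij) lmin / (h_i h_j) when i <> j.
   The two bounds on the time step therefore make the off-diagonal entries of
   the interior rows of B nonpositive and all those of C nonnegative; these rows
   have equal positive sums, since the gradients sum to 0.  Reading the scheme
   at an interior node where u^(n+1) is maximal then bounds u^(n+1) by the
   maximum of u^n and of the boundary values.

   No change of variables is needed for the mass integrals.  An affine bijection
   multiplies the Lebesgue measure by a constant (uniqueness of Haar measure),
   and this constant is read off from the image of K: it is 1 for the map
   exchanging two vertices, and 1/2 for the map moving a vertex to the midpoint
   of an edge.  The latter gives the ratio 2 between the integrals of l_i^2 and
   l_i l_j, and their values follow from (sum_i l_i)^2 = 1. *)
From HB Require Import structures.
Require Import Defs.
From mathcomp Require Import all_boot all_order all_algebra.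
From mathcomp Require Import all_classical all_reals all_analysis.
From mathcomp Require Import measurable_realfun.
From mathcomp Require Import ring lra.

Set Implicit Arguments.
Unset Strict Implicit.
Unset Printing Implicit Defensive.

Import Order.TTheory GRing.Theory Num.Theory.
Import numFieldNormedType.Exports.
Local Open Scope classical_set_scope.
Local Open Scope ring_scope.

(** * Translation-invariant measures *)

Section translation_invariance.
Context {R : realType}.
Local Notation T := (measurableTypeR R).
Implicit Type n : nat.

Definition tuple_shift n (y t : n.-tuple T) : n.-tuple T :=
  [tuple (tnth t k + tnth y k : R) | k < n].

Definition tuple_opp n (t : n.-tuple T) : n.-tuple T :=
  [tuple (- tnth t k : R) | k < n].

Definition translation_invariant n (m : set (n.-tuple T) -> \bar R) :=
  forall y A, measurable A -> m (tuple_shift y @^-1` A) = m A.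

Lemma tuple_shiftC n (y t : n.-tuple T) : tuple_shift y t = tuple_shift t y.
Proof. by apply: eq_from_tnth => k; rewrite !tnth_mktuple addrC. Qed.

Lemma tuple_shiftK n (y : n.-tuple T) :
  cancel (tuple_shift y) (tuple_shift (tuple_opp y)).
Proof. by move=> t; apply: eq_from_tnth => k; rewrite !tnth_mktuple addrK. Qed.

Lemma tuple_shift_cons n (y x : T) (s t : n.-tuple T) :
  tuple_shift (tuple_cons (y, s)) (tuple_cons (x, t)) =
  tuple_cons ((x + y : R) : T, tuple_shift s t).
Proof.
apply: eq_from_tnth => k; rewrite tnth_mktuple.
by case: (unliftP ord0 k) => [j|] ->;
  rewrite /tuple_cons ?tnthS ?tnth0 /= ?tnth_mktuple.
Qed.

Lemma measurable_mktuple d (X : measurableType d) n (f : 'I_n -> X -> R) :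
  (forall k, measurable_fun [set: X] (f k)) ->
  measurable_fun [set: X] (fun x => [tuple (f k x : T) | k < n]).
Proof.
move=> mf; apply/measurable_fun_tnthP => i.
rewrite (_ : _ \o _ = f i); first exact: mf.
by apply/funext => x /=; rewrite tnth_mktuple.
Qed.

Lemma measurable_tuple_shift n (y : n.-tuple T) :
  measurable_fun [set: n.-tuple T] (tuple_shift y).
Proof.
apply: measurable_mktuple => k; apply: measurable_funD => //.
exact: measurable_tnth.
Qed.

Lemma measurable_tuple_opp n : measurable_fun [set: n.-tuple T] (@tuple_opp n).
Proof.
apply: measurable_mktuple => k; apply: measurableT_comp => //.
exact: measurable_tnth.
Qed.

Lemma measurable_tuple_shift2 n :
  measurable_fun [set: n.-tuple T * n.-tuple T] (fun p => tuple_shift p.2 p.1).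
Proof.
apply: measurable_mktuple => k; apply: measurable_funD.
  apply: (@measurableT_comp _ _ _ _ _ _ (fun t : n.-tuple T => tnth t k)) => //.
  exact: measurable_tnth.
apply: (@measurableT_comp _ _ _ _ _ _ (fun t : n.-tuple T => tnth t k)) => //.
exact: measurable_tnth.
Qed.

Lemma measurable_preimageT d1 d2 (X : measurableType d1) (Y : measurableType d2)
    (h : X -> Y) (A : set Y) :
  measurable_fun [set: X] h -> measurable A -> measurable (h @^-1` A).
Proof. by move=> mh mA; rewrite -[X in measurable X]setTI; exact: mh. Qed.

(** Lebesgue measure is determined by its values on half-open intervals, and a translation preserves
    their lengths. *)
Lemma lebesgue_measureD (y : R) (A : set R) : measurable A ->
  pushforward lebesgue_measure ((fun x => x + y) : _ -> measurableTypeR R) A =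
  @lebesgue_measure R A.
Proof.
have mf : measurable_fun [set: T] ((fun x => x + y) : T -> T).
  exact: measurable_funD.
move=> mA; apply/esym/lebesgue_measure_unique => //= _ [[a b]] _ <-.
rewrite /pushforward (_ : _ @^-1` _ = `]a - y, b - y]%classic); last first.
  apply/seteqP; split => x /=; rewrite !in_itv /=; lra.
by rewrite !lebesgue_measure_itv /= !lte_fin ltrD2r -!EFinB opprB addrA subrK.
Qed.

Lemma ge0_integral_lebesgueD (y : R) (h : R -> \bar R) :
  measurable_fun [set: T] h -> (forall x, (0 <= h x)%E) ->
  (\int[@lebesgue_measure R]_x h (x + y)%R = \int[@lebesgue_measure R]_x h x)%E.
Proof.
move=> mh h0.
have mf : measurable_fun [set: T] ((fun x => x + y) : T -> T).
  exact: measurable_funD.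
transitivity (\int[pushforward (@lebesgue_measure R)
    ((fun x => x + y)%R : _ -> measurableTypeR R)]_x h x)%E.
  by rewrite ge0_integral_pushforward.
by apply: eq_measure_integral => //= A mA _; rewrite [LHS]lebesgue_measureD.
Qed.

Lemma leb_consE n (A : set (n.+1.-tuple T)) :
  leb n.+1 A = (\int[@lebesgue_measure R]_x
    leb n [set t | A (tuple_cons (x, t))])%E.
Proof.
apply: eq_integral => x _ /=; congr (leb n _).
by apply/seteqP; split => t /=; rewrite /xsection /= inE.
Qed.

Lemma measurable_leb_section n (A : set (n.+1.-tuple T)) : measurable A ->
  measurable_fun [set: T] (fun x => leb n [set t | A (tuple_cons (x, t))]).
Proof.
move=> mA.
have mA' := measurable_preimageT (@measurable_tuple_cons R n) mA.
have := measurable_fun_xsection (leb n) mA'.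
congr (measurable_fun _ _); apply/funext => x /=; congr (leb n _).
by apply/seteqP; split => t /=; rewrite /xsection /= inE.
Qed.

(** Induction on the dimension: the outer integral absorbs the shift of the first coordinate, the
    induction hypothesis the shift of the others inside each section. *)
Lemma leb_translation_invariant n : translation_invariant (leb n).
Proof.
elim: n => [|n IH] y A mA.
  rewrite (_ : _ @^-1` _ = A)//; apply/seteqP.
  by split=> t /=; rewrite (tuple0 t) [tuple_shift _ _]tuple0.
rewrite !leb_consE.
have yE : y = tuple_cons (thead y, behead_tuple y).
  by apply/val_inj; rewrite /= {1}(tuple_eta y).
rewrite -(ge0_integral_lebesgueD (thead y) (measurable_leb_section mA)) //.
apply: eq_integral => x _.
rewrite -[RHS](IH (behead_tuple y)).
  by congr (leb n _); apply/funext => t; rewrite /preimage /mkset {1}yE tuple_shift_cons.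
rewrite (_ : [set t | _] = (fun t => tuple_cons ((x + thead y : R) : T, t)) @^-1` A) //.
apply: measurable_preimageT => //; apply: measurable_cons => //.
exact: measurable_id.
Qed.

(** Tonelli for an indicator function: the two iterated integrals define measures that agree on
    rectangles, hence everywhere. *)
Lemma eq_integral_sections d1 d2 (X : measurableType d1) (Y : measurableType d2)
    (m1 : {sigma_finite_measure set X -> \bar R})
    (m2 : {sigma_finite_measure set Y -> \bar R}) (E : set (X * Y)) :
  measurable E ->
  (\int[m1]_x m2 [set y | E (x, y)] = \int[m2]_y m1 [set x | E (x, y)])%E.
Proof.
move=> mE.
rewrite [LHS](_ : _ = (m1 \x m2)%E E); last first.
  apply: eq_integral => x _ /=; congr (m2 _).
  by apply/seteqP; split => y; rewrite /xsection /= inE.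
rewrite [RHS](_ : _ = (m1 \x^ m2)%E E); last first.
  apply: eq_integral => y _ /=; congr (m1 _).
  by apply/seteqP; split => x; rewrite /ysection /= inE.
by apply: product_measure_unique => // A B mA mB /=; rewrite product_measure2E.
Qed.

Lemma integral_indic_cst d (X : measurableType d) (m : {measure set X -> \bar R})
    (A : set X) (h : X -> \bar R) (c : \bar R) : measurable A -> (0 <= c)%E ->
  (forall x, A x -> h x = c) -> (forall x, ~ A x -> h x = 0%E) ->
  (\int[m]_x h x = m A * c)%E.
Proof.
move=> mA c0 hA hNA.
rewrite (eq_integral (fun x => (\1_A x)%:E * c)%E); last first.
  move=> x _; rewrite indicE; have [xA|xA] := boolP (x \in A).
    by rewrite mul1e hA //; rewrite inE in xA.
  by rewrite mul0e hNA //; move: xA; rewrite notin_setE.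
rewrite ge0_integralZr ?integral_indic ?setIT//; exact: measurableT_comp.
Qed.

(* The measure of {(x, y) | x \in A, x + y \in B} is computed in both orders. *)
Lemma translation_invariant_mul_opp n
    (mu nu : {sigma_finite_measure set (n.-tuple T) -> \bar R}) A B :
  translation_invariant mu -> translation_invariant nu ->
  measurable A -> measurable B ->
  (mu A * nu B = mu B * nu (@tuple_opp n @^-1` A))%E.
Proof.
move=> imu inu mA mB.
(* Integrating over y first gives mu A * nu B for [E1] and mu B * nu (- A) for [E2]; at a fixed y
   the slices of the two sets are translates of each other by y. *)
pose E1 := [set p : n.-tuple T * n.-tuple T | A p.1 /\ B (tuple_shift p.2 p.1)].
pose E2 := [set p : n.-tuple T * n.-tuple T |
  A (tuple_shift (tuple_opp p.2) p.1) /\ B p.1].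
have msh := @measurable_tuple_shift2 n.
have mE1 : measurable E1.
  apply: measurableI; last exact: measurable_preimageT mB.
  by apply: measurable_preimageT mA; exact: measurable_fst.
have mE2 : measurable E2.
  apply: measurableI; last by apply: measurable_preimageT mB; exact: measurable_fst.
  apply: measurable_preimageT mA.
  apply: measurable_mktuple => k; apply: measurable_funD.
    apply: (@measurableT_comp _ _ _ _ _ _ (fun t : n.-tuple T => tnth t k)) => //.
    exact: measurable_tnth.
  apply: (@measurableT_comp _ _ _ _ _ _ (fun t : n.-tuple T => tnth t k)) => //.
    exact: measurable_tnth.
  apply: measurableT_comp => //; exact: measurable_tuple_opp.
have mS y C := @measurable_preimageT _ _ _ _ _ C (@measurable_tuple_shift n y).
transitivity (\int[mu]_x nu [set y | E1 (x, y)])%E.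
  rewrite (@integral_indic_cst _ _ mu A _ (nu B) mA) // => x Ax.
    rewrite (_ : [set y | _] = tuple_shift x @^-1` B) ?inu //.
    by apply/seteqP; split => y /=; rewrite /E1 /= (tuple_shiftC y) => // -[].
  by rewrite (_ : [set y | _] = set0) // -subset0 => y [].
transitivity (\int[mu]_x nu [set y | E2 (x, y)])%E; last first.
  rewrite (@integral_indic_cst _ _ mu B _ (nu (@tuple_opp n @^-1` A)) mB) // => x Bx.
    have mN := measurable_preimageT (@measurable_tuple_opp n) mA.
    rewrite (_ : [set y | _] = tuple_shift (tuple_opp x) @^-1` (@tuple_opp n @^-1` A)).
      by rewrite inu.
    have e y : tuple_shift (tuple_opp y) x =
        tuple_opp (tuple_shift (tuple_opp x) y).
      by apply: eq_from_tnth => k; rewrite !tnth_mktuple opprB addrC.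
    by apply/seteqP; split => y /=; rewrite /E2 /= e => // -[].
  by rewrite (_ : [set y | _] = set0) // -subset0 => y [].
rewrite !eq_integral_sections //; apply: eq_integral => y _.
rewrite -[RHS](imu y) /=; first by congr (mu _); apply/seteqP; split => x /=;
  rewrite /E2 /E1 /= tuple_shiftK.
rewrite (_ : [set x | _] = (tuple_shift (tuple_opp y) @^-1` A) `&` B) //.
by apply: measurableI => //; exact: mS.
Qed.

End translation_invariance.

(** * The Euclidean inner product and norm *)

Section euclidean_algebra.
Context {R : realType} {d : nat}.
Implicit Types u v w x : 'rV[R]_d.

Lemma dotvC u v : dotv u v = dotv v u.
Proof. by apply: eq_bigr => k _; rewrite mulrC. Qed.

Lemma dotvDr u v w : dotv u (v + w) = dotv u v + dotv u w.
Proof. by rewrite -big_split; apply: eq_bigr => k _; rewrite mxE mulrDr. Qed.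

Lemma dotvZr (r : R) u v : dotv u (r *: v) = r * dotv u v.
Proof. by rewrite mulr_sumr; apply: eq_bigr => k _; rewrite mxE mulrCA. Qed.

Lemma dotvZl (r : R) u v : dotv (r *: u) v = r * dotv u v.
Proof. by rewrite dotvC dotvZr dotvC. Qed.

Lemma dotvDl u v w : dotv (u + v) w = dotv u w + dotv v w.
Proof. by rewrite dotvC dotvDr !(dotvC w). Qed.

Lemma dotvNr u v : dotv u (- v) = - dotv u v.
Proof. by rewrite -scaleN1r dotvZr mulN1r. Qed.

Lemma dotvNl u v : dotv (- u) v = - dotv u v.
Proof. by rewrite dotvC dotvNr dotvC. Qed.

Lemma dotvBr u v w : dotv u (v - w) = dotv u v - dotv u w.
Proof. by rewrite dotvDr dotvNr. Qed.

Lemma dotvBl u v w : dotv (u - v) w = dotv u w - dotv v w.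
Proof. by rewrite dotvDl dotvNl. Qed.

Lemma dotv0 u : dotv u 0 = 0.
Proof. by rewrite -(scale0r 0) dotvZr mul0r. Qed.

Lemma dotv0l u : dotv 0 u = 0.
Proof. by rewrite dotvC dotv0. Qed.

Lemma dotv_sumr (I : finType) (P : pred I) u (v : I -> 'rV[R]_d) :
  dotv u (\sum_(i | P i) v i) = \sum_(i | P i) dotv u (v i).
Proof. by apply: (big_morph _ (dotvDr u)); rewrite dotv0. Qed.

Lemma dotv_ge0 u : 0 <= dotv u u.
Proof. by apply: sumr_ge0 => k _; rewrite -expr2 sqr_ge0. Qed.

Lemma dotv_eq0 u : (dotv u u == 0) = (u == 0).
Proof.
apply/idP/eqP => [|->]; last by rewrite dotv0 eqxx.
rewrite psumr_eq0; last by move=> k _; rewrite -expr2 sqr_ge0.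
move=> /allP u0; apply/rowP => k; rewrite mxE.
by have := u0 k (mem_index_enum _); rewrite mulf_eq0 orbb => /eqP.
Qed.

Lemma dotv_gt0 u : u != 0 -> 0 < dotv u u.
Proof. by move=> u0; rewrite lt_neqAle dotv_ge0 andbT eq_sym dotv_eq0. Qed.

Lemma dotv_delta u k : dotv u (delta_mx 0 k) = u 0 k.
Proof.
rewrite /dotv (bigD1 k) //= mxE !eqxx mulr1 big1 ?addr0 // => i ik.
by rewrite mxE eqxx (negbTE ik) mulr0.
Qed.

Lemma sqr_enorm u : enorm u ^+ 2 = dotv u u.
Proof. by rewrite sqr_sqrtr // dotv_ge0. Qed.

Lemma enorm_ge0 u : 0 <= enorm u. Proof. exact: sqrtr_ge0. Qed.

Lemma enorm_gt0 u : u != 0 -> 0 < enorm u.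
Proof. by move=> u0; rewrite sqrtr_gt0 dotv_gt0. Qed.

Lemma enormZ (r : R) u : enorm (r *: u) = `|r| * enorm u.
Proof. by rewrite /enorm dotvZl dotvZr mulrA -expr2 sqrtrM ?sqr_ge0 // sqrtr_sqr. Qed.

End euclidean_algebra.

Section lebesgue_affine.
Context {R : realType} {d : nat}.
Local Notation T := (measurableTypeR R).
Local Notation tup := (d.-tuple T).
Implicit Types (t : tup) (w e x : 'rV[R]_d) (c r : R).

Lemma measurable_dotv_point_of w :
  measurable_fun [set: tup] (fun t => dotv w (point_of t)).
Proof.
apply: measurable_sum => k; apply: measurable_funM => //.
rewrite (_ : (fun _ => _) = (fun t : tup => tnth t k)); first exact: measurable_tnth.
by apply/funext => t; rewrite mxE.
Qed.

Lemma measurable_affine_point_of c w :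
  measurable_fun [set: tup] (fun t => c + dotv w (point_of t)).
Proof. by apply: measurable_funD => //; exact: measurable_dotv_point_of. Qed.

Lemma point_of_shift (y t : tup) :
  point_of (tuple_shift y t) = point_of t + point_of y.
Proof. by apply/rowP => k; rewrite !mxE tnth_mktuple. Qed.

Definition tuple_of x : tup := [tuple (x 0 k : R) | k < d].

Lemma tuple_ofK : cancel tuple_of (@point_of R d).
Proof. by move=> x; apply/rowP => k; rewrite mxE tnth_mktuple. Qed.

Lemma point_ofK : cancel (@point_of R d) tuple_of.
Proof. by move=> t; apply: eq_from_tnth => k; rewrite tnth_mktuple mxE. Qed.

End lebesgue_affine.

Lemma mule_fin_inj {R : realType} (b : R) (x y : \bar R) : b != 0 ->
  (x * b%:E = y * b%:E -> x = y)%E.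
Proof.
move=> b0 /(congr1 (fun z => z * b^-1%:E)%E).
by rewrite -!muleA -!EFinM mulfV // !mule1.
Qed.

(** * Measure of cubes, and invariance of Lebesgue measure under x -> - x *)

Section cubes.
Context {R : realType}.
Local Notation T := (measurableTypeR R).

(** Cubes serve as reference sets of known finite measure, positive when [r] is. *)
Lemma leb_cube n (x : n.-tuple T) (r : R) : 0 <= r ->
  leb n [set t | forall k, `|tnth t k - tnth x k : R| <= r] = ((r *+ 2) ^+ n)%:E.
Proof.
move=> r0; elim: n x => [|n IH] x.
  rewrite /= expr0 diracE; by rewrite mem_set //; case.
case: x / (tupleP x) => a x; rewrite leb_consE.
rewrite (@integral_indic_cst R _ _ lebesgue_measure
   (`[(a : R) - r, (a : R) + r]%classic : set R) _
   ((r *+ 2) ^+ n)%:E).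
- rewrite [X in (X * _)%E](lebesgue_measure_itv `[(a : R) - r, (a : R) + r]) /=.
  rewrite lte_fin; case: ifPn => h.
    by rewrite -EFinB -EFinM exprS; congr (_ * _)%:E; lra.
  (* The interval is degenerate, and both sides vanish because the exponent is [n.+1]. *)
  have -> : r = 0 by lra.
  by rewrite mul0rn exprS mul0r mul0e.
- exact: measurable_itv.
- by rewrite lee_fin exprn_ge0 // mulrn_wge0.
- move=> y /=; rewrite in_itv /= => hy.
  rewrite -(IH x); congr (leb n _); apply/seteqP; split => t /=.
    by move=> h k; have := h (lift ord0 k); rewrite !tnthS.
  move=> h k; case: (unliftP ord0 k) => [j|] ->; first by rewrite !tnthS.
  by rewrite !tnth0 /= ler_distl.
- move=> y /=; rewrite in_itv /= => hy.
  rewrite (_ : [set t | _] = set0) ?measure0 // -subset0 => t /= /(_ ord0).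
  by rewrite !tnth0 /= ler_distl => h; apply: hy.
Qed.

Lemma measurable_cube n (x : n.-tuple T) (r : R) :
  measurable [set t : n.-tuple T | forall k, `|tnth t k - tnth x k : R| <= r].
Proof.
rewrite [X in measurable X](_ : _ = \bigcap_(k in [set: 'I_n])
    ((fun t => (tnth t k - tnth x k : R)) @^-1` `[-r, r]%classic)).
  apply: fin_bigcap_measurable => // k _.
  apply: measurable_preimageT; last exact: measurable_itv.
  by apply: measurable_funB => //; exact: measurable_tnth.
by apply/seteqP; split => t /= h k => [_|]; have := h k;
  rewrite /= in_itv /= ler_norml // => /(_ I).
Qed.

(** In [translation_invariant_mul_opp] both measures are taken to be [leb n] and [B] a cube, whose
    finite nonzero measure then cancels. *)
Lemma leb_opp n (A : set (n.-tuple T)) : measurable A ->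
  leb n (@tuple_opp R n @^-1` A) = leb n A.
Proof.
move=> mA; pose x : n.-tuple T := [tuple (0 : R) | k < n].
pose C := [set t : n.-tuple T | forall k, `|tnth t k - tnth x k : R| <= 1].
have CE : leb n C = ((1 *+ 2) ^+ n)%:E by exact: leb_cube.
have mC : measurable C by exact: measurable_cube.
have := translation_invariant_mul_opp (@leb_translation_invariant R n)
  (@leb_translation_invariant R n) mA mC.
by rewrite CE [RHS]muleC => /mule_fin_inj -> //; rewrite expf_neq0 // mulrn_eq0 oner_eq0.
Qed.

End cubes.

(** * Affine maps x + (c + w . x) e *)

Section haar.
Context {R : realType}.
Local Notation T := (measurableTypeR R).

(* Uniqueness of Haar measure, in a form without division. *)
Lemma translation_invariant_mulC n
    (mu : {sigma_finite_measure set (n.-tuple T) -> \bar R}) A B :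
  translation_invariant mu -> measurable A -> measurable B ->
  (mu A * leb n B = mu B * leb n A)%E.
Proof.
move=> imu mA mB.
rewrite (translation_invariant_mul_opp imu _ mA mB) ?leb_opp //.
exact: leb_translation_invariant.
Qed.

End haar.

Section rank_one.
Context {R : realType} {d : nat}.
Local Notation T := (measurableTypeR R).
Local Notation tup := (d.-tuple T).
Implicit Types (t : tup) (w e x : 'rV[R]_d) (c r : R).

(* The fibers of (t, s) |-> t + s w are points in s and hyperplanes in t. *)
Lemma leb_hyperplane c w : w != 0 ->
  leb d [set t | c + dotv w (point_of t) = 0] = 0%E.
Proof.
move=> w0; set H := [set t | _].
have mH : measurable H.
  rewrite (_ : H = (fun t => c + dotv w (point_of t)) @^-1` [set 0]).
    by apply: measurable_preimageT => //; exact: measurable_affine_point_of.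
  by apply/seteqP; split.
pose sw (s : R) : tup := tuple_of (s *: w).
pose E := [set p : tup * T | H (tuple_shift (sw p.2) p.1)].
have mE : measurable E.
  apply: measurable_preimageT mH; apply: measurable_mktuple => k.
  apply: measurable_funD.
    apply: (@measurableT_comp _ _ _ _ _ _ (fun t => tnth t k)) => //.
    exact: measurable_tnth.
  rewrite (_ : (fun _ => _) = (fun p : tup * T => (p.2 : R) * w 0 k)).
    by apply: measurable_funM => //; exact: measurable_snd.
  by apply/funext => p; rewrite tnth_mktuple !mxE.
have EE t (s : R) : E (t, s) = (c + dotv w (point_of t) + s * dotv w w = 0).
  by rewrite /E /H /= point_of_shift tuple_ofK dotvDr dotvZr addrA.
have := eq_integral_sections (leb d) (@lebesgue_measure R) mE.
have ww0 := dotv_gt0 w0.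
rewrite [LHS]integral0_eq; last first.
  (* A line of direction [w] meets the hyperplane in exactly one point. *)
  move=> t _; rewrite (_ : [set s | _] = [set - (c + dotv w (point_of t)) / dotv w w]).
    exact: lebesgue_measure_set1.
  apply/seteqP; split => s; rewrite /= EE.
    move=> h; apply: (mulIf (lt0r_neq0 ww0)); rewrite divfK ?gt_eqF //.
    by apply/eqP; rewrite -addr_eq0 addrC h.
  by move=> ->; rewrite divfK ?gt_eqF // subrr.
(* Each slice at fixed s is a translate of [H], so this integral is [leb d H] times the measure of
   the whole line, which is positive. *)
rewrite (_ : (fun _ => _) = cst (leb d H)); last first.
  by apply/funext => s /=; rewrite -[RHS](leb_translation_invariant (sw s) mH).
rewrite integral_cst // => /esym/eqP; rewrite mule_eq0 => /orP[/eqP //|].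
have : (0 < @lebesgue_measure R setT)%E.
  apply: (@lt_le_trans _ _ (@lebesgue_measure R `[0%R, 1%R])).
    by rewrite lebesgue_measure_itv /= lte_fin ltr01 -EFinB lte_fin subr0 ltr01.
  by apply: le_measure; rewrite ?inE //; exact: measurable_itv.
by move=> /gt_eqF ->.
Qed.

(** The linear part is a rank-one perturbation of the identity, of determinant [1 + dotv w e]. *)
Definition rank_one_map c w e t : tup :=
  tuple_shift (tuple_of ((c + dotv w (point_of t)) *: e)) t.

Lemma point_of_rank_one_map c w e t :
  point_of (rank_one_map c w e t) =
  point_of t + (c + dotv w (point_of t)) *: e.
Proof. by rewrite point_of_shift tuple_ofK. Qed.

Lemma measurable_rank_one_map c w e :
  measurable_fun [set: tup] (rank_one_map c w e).
Proof.
apply: measurable_mktuple => k; apply: measurable_funD; first exact: measurable_tnth.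
rewrite (_ : (fun _ => _) = (fun t => (c + dotv w (point_of t)) * e 0 k)).
  by apply: measurable_funM => //; exact: measurable_affine_point_of.
by apply/funext => t; rewrite tnth_mktuple mxE.
Qed.

(** The map multiplies the form c + w . x by 1 + w . e, so the displacement can be recovered from
    the image point, as in the Sherman-Morrison formula. *)
Lemma rank_one_mapK c w e : 1 + dotv w e != 0 ->
  cancel (rank_one_map c w e)
    (rank_one_map c w (- (1 + dotv w e)^-1 *: e)).
Proof.
move=> k0 t; apply: (can_inj point_ofK); rewrite !point_of_rank_one_map.
rewrite dotvDr dotvZr scalerA -addrA -scalerDl.
set l := dotv w _; set k := dotv w e in k0 *.
rewrite (_ : _ + _ * _ = 0) ?scale0r ?addr0 //.
by field.
Qed.

(** The pushforward of Lebesgue measure by an affine bijection is again translation invariant, hence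
    proportional to Lebesgue measure; proportionality is stated by cross multiplication. *)
Lemma rank_one_map_measure c w e (A B : set tup) :
  1 + dotv w e != 0 -> measurable A -> measurable B ->
  (leb d (rank_one_map c w e @^-1` A) * leb d B =
   leb d (rank_one_map c w e @^-1` B) * leb d A)%E.
Proof.
move=> k0 mA mB; set G := rank_one_map c w e.
have mG : measurable_fun setT G by exact: measurable_rank_one_map.
have mG' := @measurable_rank_one_map c w (- (1 + dotv w e)^-1 *: e).
pose m' := [the {measure set tup -> \bar R} of pushforward (leb d) G].
pose m := m' mG.
have sm : sigma_finite setT m.
  have [F FT Foo] := sigma_finiteT (@leb R d).
  (* Pulled back by the inverse map, the exhausting sets have for the pushforward the measure that
     they had for [leb d]. *)
  exists (fun k => rank_one_map c w (- (1 + dotv w e)^-1 *: e) @^-1` (F k)).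
    by rewrite -preimage_bigcup -FT preimage_setT.
  move=> k; have [mF Fk] := Foo k; split; first exact: measurable_preimageT.
  rewrite /m /= /pushforward -comp_preimage (_ : _ \o _ = id) //.
  by apply/funext => t /=; rewrite rank_one_mapK.
pose sfm := Measure_isSigmaFinite.Build _ _ _ m sm.
pose mu : {sigma_finite_measure set tup -> \bar R} := HB.pack (Measure.sort m) sfm.
have imu : translation_invariant mu.
  move=> y C mC; rewrite /mu /m /= /pushforward.
  (* [z] solves z + (w . z) e = y, so that [G] turns the translation by [z] into the translation by
     [y]. *)
  set z : 'rV[R]_d := point_of y - (dotv w (point_of y) / (1 + dotv w e)) *: e.
  rewrite -[RHS](leb_translation_invariant (tuple_of z)); last first.
    exact: measurable_preimageT.
  congr (leb d _); apply/funext => t; rewrite /preimage /mkset; congr (C _).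
  apply: (can_inj point_ofK).
  rewrite point_of_shift !point_of_rank_one_map point_of_shift tuple_ofK.
  rewrite /z !(dotvDr, dotvNr, dotvZr).
  set l := dotv w (point_of t); set q := dotv w (point_of y).
  set k := dotv w e in k0 *.
  apply/rowP => i; rewrite !mxE; field.
  exact: k0.
exact: (translation_invariant_mulC imu mA mB).
Qed.

End rank_one.

Section rank_one_integral.
Context {R : realType} {d : nat}.
Local Notation tup := (d.-tuple (measurableTypeR R)).
Variables (c : R) (w e : 'rV[R]_d).
Hypothesis we : 1 + dotv w e != 0.
Local Notation G := (rank_one_map c w e).

(** Change of variables in which the factor [r] is read off from a single reference set [B] of
    positive finite measure, without computing a determinant. *)
Lemma ge0_integral_rank_one_map (r : R) (A B : set tup) (F : tup -> \bar R) :
  0 <= r -> measurable A -> measurable B -> (0 < leb d B < +oo)%E ->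
  (leb d (G @^-1` B) = r%:E * leb d B)%E ->
  measurable_fun A F -> (forall t, A t -> 0 <= F t)%E ->
  (\int[leb d]_(t in G @^-1` A) F (G t) = r%:E * \int[leb d]_(t in A) F t)%E.
Proof.
move=> r0 mA mB /andP[B0 Boo] GB mF F0.
have leb_scale X : measurable X -> (leb d (G @^-1` X) = r%:E * leb d X)%E.
  move=> mX; have := rank_one_map_measure c we mX mB; rewrite GB.
  have Bfin : leb d B \is a fin_num by rewrite ge0_fin_numE // ltW.
  rewrite -(fineK Bfin) in B0 *; set b := fine _ in B0 *.
  rewrite lte_fin in B0; rewrite -[RHS]muleA [(b%:E * _)%E]muleC muleA.
  by apply: mule_fin_inj; rewrite gt_eqF.
have -> : (\int[leb d]_(t in G @^-1` A) F (G t) =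
    \int[pushforward (leb d) G]_(t in A) F t)%E.
  rewrite ge0_integral_pushforward //; first exact: measurable_rank_one_map.
  by move=> t /[!inE]; exact: F0.
rewrite -(ge0_integral_mscale (leb d) mA (NngNum r0)) //.
apply: eq_measure_integral => [|mG X mX _]; first exact: measurable_rank_one_map.
exact: leb_scale.
Qed.

End rank_one_integral.

(** Integrability and value are proved together, since additivity at each stage of the induction
    requires the partial sum to be integrable. *)
Lemma Rintegral_sum d (X : measurableType d) (R : realType)
    (mu : {measure set X -> \bar R}) (D : set X) (mD : measurable D)
    (I : finType) (P : pred I) (f : I -> X -> R) :
  (forall k, P k -> mu.-integrable D (EFin \o f k)) ->
  mu.-integrable D (EFin \o (fun t => \sum_(k | P k) f k t)) /\
  \int[mu]_(t in D) (\sum_(k | P k) f k t) = \sum_(k | P k) \int[mu]_(t in D) f k t.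
Proof.
move=> If.
have eS (s : seq I) : (fun t => \sum_(k <- s | P k) f k t) =
    \sum_(k <- s | P k) f k.
  by apply/funext => t; rewrite fct_sumE.
rewrite eS; elim/big_rec2: _ => [|k S g Pk [iS eS']].
  by split; [exact: integrable0|rewrite Rintegral_cst // mul0r].
by split; [exact: (integrableD mD (If k Pk) iS)|rewrite RintegralD ?eS' //; exact: If].
Qed.

(** * Barycentric coordinates and mass integrals of a simplex *)

Section simplex.
Context {R : realType} {d n : nat} (a : 'I_n -> 'rV[R]_d) (K : {set 'I_n}).
Hypotheses (cardK : #|K| = d.+1) (affK : affinely_independent a K).
Variables (c : 'I_n -> R) (w : 'I_n -> 'rV[R]_d).
Hypothesis bary_vertex : forall i j, i \in K -> j \in K ->
  c j + dotv (w j) (a i) = (i == j)%:R.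
Implicit Types (x y : 'rV[R]_d) (i j : 'I_n).

(** Under [bary_vertex], for [j] in [K], this is the barycentric coordinate of the vertex [a j], and
    [w j] is its gradient. *)
Definition bary j x := c j + dotv (w j) x.

(** The matrix with rows (1, a_i) is square because [K] has d + 1 elements; affine independence
    makes its rows free, so they span the whole space. *)
Lemma affine_hull_full x :
  exists2 m : 'I_n -> R, \sum_(i in K) m i = 1 & x = \sum_(i in K) m i *: a i.
Proof.
(* Coefficients on the enumeration of [K], extended by 0 to all indices. *)
pose ext (v : 'rV[R]_#|K|) i := \sum_(k < #|K| | enum_val k == i) v 0 k.
have extE v k : ext v (enum_val k) = v 0 k.
  rewrite /ext (eq_bigl (pred1 k)) ?big_pred1_eq // => l.
  by rewrite (inj_eq enum_val_inj).
pose M : 'M[R]_(#|K|, 1 + d) := \matrix_(k < #|K|) row_mx 1%:M (a (enum_val k)).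
have Ml v : v *m M = row_mx (\sum_(i in K) ext v i)%:M (\sum_(i in K) ext v i *: a i).
  rewrite mulmx_sum_row (big_enum_val (ext v)).
  rewrite (big_enum_val (fun i => ext v i *: a i)) /=.
  under eq_bigr do rewrite rowK scale_row_mx.
  have -> : row_mx (\sum_(k < #|K|) ext v (enum_val k))%:M
      (\sum_(k < #|K|) ext v (enum_val k) *: a (enum_val k)) =
      \sum_(k < #|K|) row_mx (v 0 k)%:M (v 0 k *: a (enum_val k)).
    elim/big_rec3: _ => [|k m s t _ <-].
      by rewrite -scalemx1 scale0r row_mx0.
    by rewrite add_row_mx raddfD /= extE.
  by apply: eq_bigr => k _; rewrite scalemx1.
have Mfree : row_free M.
  apply: inj_row_free => v; rewrite Ml -row_mx0 => /eq_row_mx[h0 h2].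
  have := congr1 (fun A : 'M[R]_(1, 1) => A 0 0) h0; rewrite !mxE eqxx mulr1n => h1.
  by apply/rowP => k; rewrite -extE mxE (affK h1 h2) // enum_valP.
have Mfull : row_full M by rewrite /row_full (eqP Mfree) cardK.
have /submxP[D DE] : (row_mx 1%:M x <= M)%MS by exact: submx_full.
rewrite Ml in DE; have [h1 h2] := eq_row_mx DE; exists (ext D) => //.
by have := congr1 (fun A : 'M[R]_(1, 1) => A 0 0) h1; rewrite !mxE eqxx !mulr1n.
Qed.

Lemma bary_comb (m : 'I_n -> R) j : j \in K -> \sum_(i in K) m i = 1 ->
  bary j (\sum_(i in K) m i *: a i) = m j.
Proof.
move=> jK m1; rewrite /bary dotv_sumr -[c j]mulr1 -m1 mulr_sumr -big_split /=.
rewrite (bigD1 j) //= big1 ?addr0 => [|i /andP[iK ij]].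
  by rewrite dotvZr mulrC -mulrDr bary_vertex // eqxx mulr1.
by rewrite dotvZr mulrC -mulrDr bary_vertex // (negbTE ij) mulr0.
Qed.

Lemma sum_bary x : \sum_(j in K) bary j x = 1.
Proof.
have [m m1 ->] := affine_hull_full x.
by rewrite -[RHS]m1; apply: eq_bigr => j jK; rewrite bary_comb.
Qed.

Lemma baryE x : x = \sum_(j in K) bary j x *: a j.
Proof.
have [m m1 xE] := affine_hull_full x.
by rewrite {1}xE; apply: eq_bigr => j jK; rewrite xE bary_comb.
Qed.

(** This description by finitely many affine inequalities is the one used for measurability and for
    sign arguments. *)
Lemma conv_hull_bary : conv_hull a K = [set x | forall j, j \in K -> 0 <= bary j x].
Proof.
apply/seteqP; split => x /=.
  by move=> [m [m0 m1 ->]] j jK; rewrite bary_comb //; exact: m0.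
move=> h; exists (bary^~ x); split => //; first exact: sum_bary.
exact: baryE.
Qed.

Lemma baryD j x y : bary j (x + y) = bary j x + dotv (w j) y.
Proof. by rewrite /bary dotvDr addrA. Qed.

Lemma dotv_edge i j k : i \in K -> j \in K -> k \in K ->
  dotv (w k) (a i - a j) = (i == k)%:R - (j == k)%:R.
Proof. by move=> iK jK kK; rewrite dotvBr -!bary_vertex //; ring. Qed.

Lemma sum_dotv_bary y : \sum_(j in K) dotv (w j) y = 0.
Proof.
have := sum_bary (0 + y); under eq_bigr do rewrite baryD.
by rewrite big_split /= sum_bary => /(canRL (addKr 1)) ->; rewrite addNr.
Qed.

(** The sum of the gradients is orthogonal to every vector, in particular to itself. *)
Lemma sum_bary_grad : \sum_(j in K) w j = 0.
Proof.
apply/eqP; rewrite -dotv_eq0 dotv_sumr; apply/eqP.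
rewrite -[RHS](sum_dotv_bary (\sum_(j in K) w j)).
by apply: eq_bigr => j _; rewrite dotvC.
Qed.

Lemma bary_barycenter j : j \in K -> bary j (barycenter a K) = (d.+1%:R)^-1.
Proof.
move=> jK; rewrite /barycenter cardK scaler_sumr bary_comb //.
by rewrite sumr_const cardK -[_ *+ _]mulr_natl mulfV // pnatr_eq0.
Qed.

Hypothesis d_gt0 : (0 < d)%N.

Lemma exists_other_vertex i : i \in K -> exists2 j, j \in K & j != i.
Proof.
move=> iK; have : (0 < #|K :\ i|)%N.
  by have := cardsD1 i K; rewrite iK cardK add1n => -[<-].
by move=> /card_gt0P[j]; rewrite !inE => /andP[ji jK]; exists j.
Qed.

Lemma bary_grad_neq0 j : j \in K -> w j != 0.
Proof.
move=> jK; have [i iK ij] := exists_other_vertex jK.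
apply/negP => /eqP w0; have := dotv_edge jK iK jK.
by rewrite w0 dotv0l eqxx (negbTE ij) subr0 => /eqP; rewrite eq_sym oner_eq0.
Qed.

Lemma bary_le1 j x : conv_hull a K x -> j \in K -> bary j x <= 1.
Proof.
rewrite conv_hull_bary /= => h jK; rewrite -(sum_bary x) (bigD1 j) //= lerDl.
by apply: sumr_ge0 => i /andP[iK _]; exact: h.
Qed.

Local Notation T := (measurableTypeR R).
Local Notation P := (@point_of R d @^-1` conv_hull a K).

Definition open_simplex : set 'rV[R]_d :=
  [set x | forall j, j \in K -> 0 < bary j x].

Lemma measurable_bary j : measurable_fun [set: d.-tuple T] (fun t => bary j (point_of t)).
Proof. exact: measurable_affine_point_of. Qed.

Lemma measurable_forall_bary (A : 'I_n -> set R) : (forall j, measurable (A j)) ->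
  measurable [set t : d.-tuple T | forall j, j \in K -> A j (bary j (point_of t))].
Proof.
move=> mA; rewrite [X in measurable X](_ : _ = \bigcap_(j in [set` K])
   ((fun t => bary j (point_of t)) @^-1` (A j))); last first.
  by apply/seteqP; split => t h j; exact: h.
apply: fin_bigcap_measurable => // j _.
by apply: measurable_preimageT => //; exact: measurable_bary.
Qed.

Lemma measurable_simplex : measurable P.
Proof.
rewrite conv_hull_bary; have := @measurable_forall_bary (fun=> `[0, +oo[%classic).
rewrite (_ : [set t | _] = point_of @^-1` [set x | forall j, j \in K -> 0 <= bary j x]).
  by apply=> j; exact: measurable_itv.
by apply/seteqP; split => t /= h j /h; rewrite in_itv /= andbT.
Qed.

Lemma measurable_open_simplex : measurable (@point_of R d @^-1` open_simplex).
Proof.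
have := @measurable_forall_bary (fun=> `]0, +oo[%classic).
rewrite (_ : [set t | _] = point_of @^-1` open_simplex).
  by apply=> j; exact: measurable_itv.
by apply/seteqP; split => t /= h j /h; rewrite in_itv /= andbT.
Qed.

Lemma open_simplex_sub : open_simplex `<=` conv_hull a K.
Proof. by rewrite conv_hull_bary => x h j jK; exact/ltW/h. Qed.

(** The simplex lies in a cube around the origin whose radius dominates all coordinates of the
    vertices. *)
Lemma leb_simplex_lty : (leb d P < +oo)%E.
Proof.
pose r := \sum_(k < d) \sum_(j in K) `|a j 0 k|.
have r0 : 0 <= r by apply: sumr_ge0 => k _; apply: sumr_ge0.
pose C := [set t : d.-tuple T |
  forall k, `|tnth t k - tnth (tuple_of 0 : d.-tuple T) k : R| <= r].
apply: (@le_lt_trans _ _ (leb d C)); last by rewrite leb_cube // ltry.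
apply: le_measure; rewrite ?inE.
- exact: measurable_simplex.
- exact: measurable_cube.
move=> t /= tK k; rewrite tnth_mktuple mxE subr0.
have -> : (tnth t k : R) = point_of t 0 k by rewrite mxE.
rewrite (baryE (point_of t)) summxE /r (bigD1 k) //=.
apply: (@le_trans _ _ (\sum_(j in K) `|a j 0 k|)); last first.
  by rewrite lerDl; apply: sumr_ge0 => i _; apply: sumr_ge0.
apply: le_trans (ler_norm_sum _ _ _) _; apply: ler_sum => j jK.
rewrite mxE normrM ger0_norm; last by move: tK; rewrite conv_hull_bary; exact.
by apply: ler_piMl => //; exact: bary_le1.
Qed.

(** A small cube around the barycenter, where all barycentric coordinates equal 1 / (d + 1), stays
    in the open simplex. *)
Lemma leb_open_simplex_gt0 : (0 < leb d (@point_of R d @^-1` open_simplex))%E.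
Proof.
pose s := \sum_(j in K) \sum_(k < d) `|w j 0 k|.
have s0 : 0 <= s by apply: sumr_ge0 => k _; apply: sumr_ge0.
(* Over the cube each coordinate varies by at most s r, which is less than 1 / (d + 1); the summand
   1 makes this strict and avoids a zero denominator. *)
pose r := (d.+1%:R * (1 + s))^-1.
have r0 : 0 < r by rewrite invr_gt0 mulr_gt0 // ltr_wpDr.
pose C := [set t : d.-tuple T |
  forall k, `|tnth t k - tnth (tuple_of (barycenter a K) : d.-tuple T) k : R| <= r].
apply: (@lt_le_trans _ _ (leb d C)).
  by rewrite leb_cube ?ltW // lte_fin exprn_gt0 // mulrn_wgt0.
apply: le_measure; rewrite ?inE.
- exact: measurable_cube.
- exact: measurable_open_simplex.
move=> t /= h j jK.
rewrite -[point_of t](subrK (barycenter a K)) addrC baryD bary_barycenter //.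
set y := point_of t - _.
have yk k : `|y 0 k| <= r by have := h k; rewrite tnth_mktuple !mxE.
have : `|dotv (w j) y| <= s * r.
  apply: le_trans (ler_norm_sum _ _ _) _.
  rewrite /s (bigD1 j) //= mulrDl.
  apply: (@le_trans _ _ ((\sum_(k < d) `|w j 0 k|) * r)); last first.
    rewrite lerDl; apply: mulr_ge0; last exact: ltW.
    by apply: sumr_ge0 => i _; apply: sumr_ge0.
  rewrite mulr_suml; apply: ler_sum => k _; rewrite normrM.
  by apply: ler_wpM2l.
rewrite ler_norml => /andP[h1 _].
apply: lt_le_trans (lerD (lexx _) h1).
rewrite subr_gt0 /r invfM mulrCA -[ltRHS]mulr1 ltr_pM2l ?invr_gt0 //.
by rewrite ltr_pdivrMr ?ltr_wpDr // mul1r ltrDr.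
Qed.

Lemma leb_simplex_gt0 : (0 < leb d P)%E.
Proof.
apply: lt_le_trans leb_open_simplex_gt0 _; apply: le_measure; rewrite ?inE.
- exact: measurable_open_simplex.
- exact: measurable_simplex.
by move=> t; exact: open_simplex_sub.
Qed.

(** The difference is covered by the hyperplanes where one barycentric coordinate vanishes, and
    these are null sets. *)
Lemma leb_simplex_boundary :
  leb d (P `\` (@point_of R d @^-1` open_simplex)) = 0%E.
Proof.
apply/eqP; rewrite eq_le measure_ge0 andbT.
pose H j := [set t : d.-tuple T | c j + dotv (w j) (point_of t) = 0].
have mH j : measurable (H j).
  rewrite (_ : H j = (fun t => bary j (point_of t)) @^-1` [set 0]) //.
  by apply: measurable_preimageT => //; exact: measurable_bary.
have [mU U0] : measurable (\big[setU/set0]_(j <- enum K) H j) /\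
    leb d (\big[setU/set0]_(j <- enum K) H j) = 0%E.
  rewrite big_seq; elim/big_ind: _ => [|A B [mA A0] [mB B0]|j].
  - by split => //; rewrite measure0.
  - by split; [exact: measurableU|exact: null_set_setU].
  - by rewrite mem_enum => jK; split; [exact: mH|exact/leb_hyperplane/bary_grad_neq0].
rewrite -U0; apply: le_measure; rewrite ?inE //.
  by apply: measurableD; [exact: measurable_simplex|exact: measurable_open_simplex].
move=> t [tK /= tNo]; rewrite -bigcup_seq; apply: contrapT => tNH; apply: tNo => j jK.
rewrite lt_neqAle; move: tK; rewrite conv_hull_bary => /(_ j jK) ->; rewrite andbT.
apply/negP => /eqP h; apply: tNH; exists j => /=; first by rewrite mem_enum.
by rewrite /H /= -/(bary j _) -h.
Qed.

Lemma integrable_bary_mul k l : k \in K -> l \in K ->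
  integrable_on (conv_hull a K) (fun x => bary k x * bary l x).
Proof.
move=> kK lK; apply: measurable_bounded_integrable.
- exact: measurable_simplex.
- exact: leb_simplex_lty.
- by apply: measurable_funTS; apply: measurable_funM; exact: measurable_bary.
exists 1; split => // y y1 t /= tP; apply: le_trans (ltW y1).
have := tP; rewrite conv_hull_bary => h.
by rewrite ger0_norm ?mulr_ge0 ?mulr_ile1 ?h ?bary_le1.
Qed.

(** * Exchanging and folding two vertices of a simplex *)

Section two_vertices.
Variables (i j : 'I_n).
Hypotheses (iK : i \in K) (jK : j \in K) (ij : i != j).

Let half := P `&` [set t | bary j (point_of t) <= bary i (point_of t)].
(* swap exchanges the vertices i and j, hence preserves the simplex and its
   volume; fold moves the vertex j to the midpoint of the edge, hence maps the
   simplex onto half, which has half its volume. *)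
Let swap := rank_one_map (c i - c j) (w i - w j) (a j - a i).
Let fold := rank_one_map (c j) (w j) (2^-1 *: (a i - a j)).

Let bary_swap k t : k \in K -> bary k (point_of (swap t)) =
  bary k (point_of t) +
  (bary i (point_of t) - bary j (point_of t)) * ((j == k)%:R - (i == k)%:R).
Proof.
move=> kK; rewrite point_of_rank_one_map baryD dotvZr dotv_edge //.
by rewrite dotvBl /bary; ring.
Qed.

Let bary_fold k t : k \in K -> bary k (point_of (fold t)) =
  bary k (point_of t) + bary j (point_of t) * 2^-1 * ((i == k)%:R - (j == k)%:R).
Proof.
by move=> kK; rewrite point_of_rank_one_map baryD !dotvZr dotv_edge // mulrA.
Qed.

Let swap_unit : 1 + dotv (w i - w j) (a j - a i) != 0.
Proof.
rewrite dotvBl !dotv_edge // !eqxx (negbTE ij) (eq_sym j) (negbTE ij) /=.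
rewrite (_ : _ + _ = -1); first by rewrite oppr_eq0 oner_eq0.
by ring.
Qed.

Let fold_unit : 1 + dotv (w j) (2^-1 *: (a i - a j)) != 0.
Proof.
rewrite dotvZr dotv_edge // eqxx (negbTE ij) /=.
rewrite (_ : _ + _ = 2^-1); first by rewrite invr_eq0 pnatr_eq0.
by field.
Qed.

Let mhalf : measurable half.
Proof.
apply: measurableI; first exact: measurable_simplex.
rewrite [X in measurable X](_ : _ =
   (fun t => bary i (point_of t) - bary j (point_of t)) @^-1` `[0, +oo[%classic).
  apply: measurable_preimageT; last exact: measurable_itv.
  by apply: measurable_funB; exact: measurable_bary.
by apply/seteqP; split => t /=; rewrite in_itv /= andbT subr_ge0.
Qed.

Let bary_swap_l t : bary i (point_of (swap t)) = bary j (point_of t).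
Proof. by rewrite bary_swap // eqxx (eq_sym j) (negbTE ij) /=; ring. Qed.

Let bary_swap_r t : bary j (point_of (swap t)) = bary i (point_of t).
Proof. by rewrite bary_swap // eqxx (negbTE ij) /=; ring. Qed.

Let bary_swap_o k t : k \in K -> k != i -> k != j ->
  bary k (point_of (swap t)) = bary k (point_of t).
Proof.
move=> kK ki kj; rewrite bary_swap // (eq_sym j) (eq_sym i).
by rewrite (negbTE ki) (negbTE kj) /=; ring.
Qed.

Let swap_simplex : swap @^-1` P = P.
Proof.
apply/seteqP; split => t; rewrite /preimage conv_hull_bary /= => h k kK.
  have [->|ki] := eqVneq k i; first by rewrite -bary_swap_r; exact: h.
  have [->|kj] := eqVneq k j; first by rewrite -bary_swap_l; exact: h.
  by rewrite -bary_swap_o //; exact: h.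
have [->|ki] := eqVneq k i; first by rewrite bary_swap_l; exact: h.
have [->|kj] := eqVneq k j; first by rewrite bary_swap_r; exact: h.
by rewrite bary_swap_o //; exact: h.
Qed.

Let swap_half : swap @^-1` half =
  P `&` [set t | bary i (point_of t) <= bary j (point_of t)].
Proof.
rewrite /half preimage_setI swap_simplex; congr (_ `&` _).
by apply/funext => t; rewrite /preimage /mkset bary_swap_l bary_swap_r.
Qed.

Let bary_fold_l t : bary i (point_of (fold t)) =
  bary i (point_of t) + bary j (point_of t) / 2.
Proof. by rewrite bary_fold // eqxx (eq_sym j) (negbTE ij) /=; ring. Qed.

Let bary_fold_r t : bary j (point_of (fold t)) = bary j (point_of t) / 2.
Proof. by rewrite bary_fold // eqxx (negbTE ij) /=; field. Qed.

Let bary_fold_o k t : k \in K -> k != i -> k != j ->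
  bary k (point_of (fold t)) = bary k (point_of t).
Proof.
move=> kK ki kj; rewrite bary_fold // (eq_sym j) (eq_sym i).
by rewrite (negbTE ki) (negbTE kj) /=; ring.
Qed.

(** At the image point the inequality defining [half] reads l_j / 2 <= l_i + l_j / 2, that is, 0 <=
    l_i. *)
Let fold_half : fold @^-1` half = P.
Proof.
apply/seteqP; split => t; rewrite /preimage /half conv_hull_bary /=.
  rewrite bary_fold_l bary_fold_r => -[h h'] k kK.
  have [->|ki] := eqVneq k i; first lra.
  have [->|kj] := eqVneq k j; first by have := h j jK; rewrite bary_fold_r; lra.
  by rewrite -bary_fold_o //; exact: h.
move=> h; have h1 := h i iK; have h2 := h j jK.
split; last by rewrite bary_fold_l bary_fold_r; lra.
move=> k kK; have [->|ki] := eqVneq k i; first by rewrite bary_fold_l; lra.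
have [->|kj] := eqVneq k j; first by rewrite bary_fold_r; lra.
by rewrite bary_fold_o //; exact: h.
Qed.

Let swap_scale : leb d (swap @^-1` P) = (1%:E * leb d P)%E.
Proof. by rewrite swap_simplex mul1e. Qed.

Let P_bound : (0 < leb d P < +oo)%E.
Proof. by rewrite leb_simplex_gt0 leb_simplex_lty. Qed.

(** Up to the null set where l_i = l_j, [swap] exchanges [half] with its complement in the simplex,
    and it leaves both volume and [F] unchanged. *)
Let ge0_integral_half (F : d.-tuple T -> \bar R) :
  measurable_fun P F -> (forall t, P t -> 0 <= F t)%E ->
  (forall t, F (swap t) = F t) ->
  (\int[leb d]_(t in P) F t =
   \int[leb d]_(t in half) F t + \int[leb d]_(t in half) F t)%E.
Proof.
move=> mF F0 Fswap.
have mP := measurable_simplex.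
have mlt : measurable (P `\` half) by exact: measurableD.
have mD := @measurable_affine_point_of R d (c i - c j) (w i - w j).
pose H := P `&` [set t | c i - c j + dotv (w i - w j) (point_of t) = 0].
have mH : measurable H.
  by apply: measurableI => //; exact: measurable_preimageT (measurable_set1 0).
have HE t : (c i - c j + dotv (w i - w j) (point_of t) = 0) <->
    (bary i (point_of t) = bary j (point_of t)).
  rewrite dotvBl addrACA -opprD -/(bary i _) -/(bary j _).
  by split => [/subr0_eq //|->]; exact: subrr.
have PE : P = half `|` (P `\` half).
  by rewrite setDUK // => t [].
have swapE : swap @^-1` half = (P `\` half) `|` H.
  rewrite swap_half; apply/seteqP; split => t /=.
    move=> [tP]; rewrite le_eqVlt => /orP[/eqP h|h]; first by right; split=> //; exact/HE.
    by left; split=> // -[_] /=; rewrite leNgt h.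
  move=> [[tP]|[tP /HE->]]; last by [].
  by move=> h; split=> //; rewrite leNgt; apply/negP => /ltW h'; apply: h.
have mFs X : measurable X -> X `<=` P -> measurable_fun X F.
  by move=> mX XP; exact: measurable_funS XP mF.
rewrite {1}PE ge0_integral_setU //; first last.
- by apply/disj_setPS => t [? []].
- by rewrite -PE.
- by rewrite -PE.
congr (_ + _)%E.
have hP : half `<=` P by move=> t [].
have := ge0_integral_rank_one_map swap_unit ler01 mhalf mP P_bound swap_scale
  (mFs _ mhalf hP) (fun t h => F0 t (hP t h)).
rewrite mul1e => <-; rewrite -/swap.
under [RHS]eq_integral do rewrite Fswap.
have sP : swap @^-1` half `<=` P by rewrite swap_half => t [].
have HP : H `<=` P by move=> t [].
have H0 : leb d H = 0%E.
  apply/eqP; rewrite eq_le measure_ge0 andbT.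
  rewrite -(@leb_hyperplane R d (c i - c j) (w i - w j)).
    apply: le_measure; rewrite ?inE //; last by move=> t [].
    exact: measurable_preimageT (measurable_set1 0).
  (* If [w i] and [w j] were equal, their products with the edge [a i - a j] would give 1 = -1. *)
  apply/negP => /eqP w0; have := dotv_edge iK jK iK.
  rewrite (subr0_eq w0) dotv_edge // !eqxx (negbTE ij) (eq_sym j) (negbTE ij) /=.
  by rewrite sub0r subr0 => /eqP; rewrite eq_sym -subr_eq0 opprK -mulr2n pnatr_eq0.
rewrite swapE ge0_integral_setU //; first last.
- apply/disj_setPS => t [[_ tN] [tP /HE h]]; apply: tN; split => //=.
  by rewrite h.
- by rewrite -swapE => t /sP; exact: F0.
- rewrite -swapE; apply: mFs => //; apply: measurable_preimageT => //.
  exact: measurable_rank_one_map.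
by rewrite (null_set_integral mH (mFs _ mH HP) H0) adde0.
Qed.

Let leb_half : leb d P = (2%:E * leb d half)%E.
Proof.
have := @ge0_integral_half (cst 1%E) (@measurable_cst _ _ _ _ _ _)
  (fun t _ => lee01) (fun t => erefl).
rewrite !integral_cst ?mul1e //; last exact: measurable_simplex.
by move=> ->; rewrite mule_natl mule2n.
Qed.

(** Both sides are twice the integral over [half]: the left one by symmetry, the right one because
    the preimage of [half] under [fold] is the simplex, of twice its volume. *)
Let ge0_integral_fold (F : d.-tuple T -> \bar R) :
  measurable_fun P F -> (forall t, P t -> 0 <= F t)%E ->
  (forall t, F (swap t) = F t) ->
  (\int[leb d]_(t in P) F t = \int[leb d]_(t in P) F (fold t))%E.
Proof.
move=> mF F0 Fswap; rewrite ge0_integral_half //.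
have hP : half `<=` P by move=> t [].
have hb : (0 < leb d half < +oo)%E.
  apply/andP; split; last first.
    apply: le_lt_trans leb_simplex_lty; apply: le_measure; rewrite ?inE //.
    exact: measurable_simplex.
  rewrite lt_neqAle measure_ge0 andbT; apply/negP => /eqP h.
  by have := leb_simplex_gt0; rewrite leb_half -h mule0 ltxx.
have fs : leb d (fold @^-1` half) = (2%:E * leb d half)%E.
  by rewrite fold_half -leb_half.
have := ge0_integral_rank_one_map fold_unit (ler0n R 2) mhalf mhalf hb fs
  (measurable_funS measurable_simplex hP mF) (fun t h => F0 t (hP t h)).
by rewrite -/fold fold_half => ->; rewrite mule_natl mule2n.
Qed.

(* Pulling back along fold gives p = p / 2 + q / 4 for the integrals p of
   l_i l_j and q of l_j^2. *)
Lemma integral_bary_offdiag :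
  integral_on (conv_hull a K) (fun x => bary i x * bary j x) =
  integral_on (conv_hull a K) (fun x => bary j x * bary j x) / 2.
Proof.
have mij : measurable_fun [set: d.-tuple T]
    (fun t => (bary i (point_of t) * bary j (point_of t))%:E).
  by apply/measurable_EFinP; apply: measurable_funM; exact: measurable_bary.
have F0 t : P t -> (0 <= (bary i (point_of t) * bary j (point_of t))%:E)%E.
  by rewrite conv_hull_bary /= lee_fin => h; rewrite mulr_ge0 ?h.
have Fswap t : (bary i (point_of (swap t)) * bary j (point_of (swap t)))%:E =
    (bary i (point_of t) * bary j (point_of t))%:E.
  by rewrite bary_swap_l bary_swap_r mulrC.
have := congr1 fine (ge0_integral_fold (measurable_funTS mij) F0 Fswap).
rewrite [LHS](_ : _ = integral_on (conv_hull a K) (fun x => bary i x * bary j x)) //.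
rewrite [RHS](_ : _ = \int[leb d]_(t in P)
  (2^-1 * (bary i (point_of t) * bary j (point_of t)) +
   4^-1 * (bary j (point_of t) * bary j (point_of t)))); last first.
  congr fine; apply: eq_integral => t _; congr _%:E.
  by rewrite bary_fold_l bary_fold_r; field.
have mP := measurable_simplex.
have I1 := integrable_bary_mul iK jK; have I2 := integrable_bary_mul jK jK.
have I1' : (leb d).-integrable P (EFin \o (fun t =>
  2^-1 * (bary i (point_of t) * bary j (point_of t)))).
  exact: (integrableZl mP 2^-1 I1).
have I2' : (leb d).-integrable P (EFin \o (fun t =>
  4^-1 * (bary j (point_of t) * bary j (point_of t)))).
  exact: (integrableZl mP 4^-1 I2).
rewrite RintegralD // !RintegralZl //.
rewrite -!/(integral_on _ _) /integral_on.
set p := \int[_]_(_ in _) _; set q := \int[_]_(_ in _) _ => e.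
lra.
Qed.

End two_vertices.

Local Notation J k l := (integral_on (conv_hull a K) (fun x => bary k x * bary l x)).

Lemma integral_bary_sum : \sum_(k in K) \sum_(l in K) J k l = volume (conv_hull a K).
Proof.
have mP := measurable_simplex.
have sumK f := @Rintegral_sum _ _ _ (leb d) _ mP _ (mem K) f.
rewrite /integral_on.
under eq_bigr => k kK.
  rewrite -(sumK (fun l t => bary k (point_of t) * bary l (point_of t)) _).2; last first.
    by move=> l lK; exact: integrable_bary_mul.
  over.
rewrite -(sumK (fun k t => \sum_(l in K) bary k (point_of t) * bary l (point_of t)) _).2.
  rewrite (_ : (fun t => _) = cst 1).
    by rewrite Rintegral_cst // mul1r.
  apply/funext => t; under eq_bigr do rewrite -mulr_sumr sum_bary mulr1.
  exact: sum_bary.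
move=> k kK; apply: (sumK (fun l t => bary k (point_of t) * bary l (point_of t)) _).1.
by move=> l lK; exact: integrable_bary_mul.
Qed.

Lemma integral_bary_mul k l : k \in K -> l \in K ->
  J k l = (1 + (k == l)%:R) * volume (conv_hull a K) / (d.+1%:R * d.+2%:R).
Proof.
move=> kK lK.
have JC i j : J i j = J j i.
  by apply: eq_Rintegral => t _; rewrite mulrC.
have offdiag i j : i \in K -> j \in K -> i != j -> J i j = J j j / 2.
  by move=> iK jK ij; rewrite integral_bary_offdiag.
(* For distinct i and l, the symmetric integral of l_i l_l is half of either diagonal integral, so
   these agree. *)
have diag i : i \in K -> J i i = J l l.
  move=> iK; have [->//|il] := eqVneq i l.
  have := offdiag _ _ iK lK il; rewrite JC offdiag //; last by rewrite eq_sym.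
  by lra.
have JE i j : i \in K -> j \in K -> J i j = J l l / 2 + (i == j)%:R * (J l l / 2).
  move=> iK jK; have [->|ij] := eqVneq i j; first by rewrite diag //=; field.
  by rewrite offdiag // diag // mul0r addr0.
(* Each of the d + 1 rows contributes (d + 2) / 2 times the common diagonal value, which determines
   that value. *)
have := integral_bary_sum.
under eq_bigr => i iK.
  under eq_bigr => j jK do rewrite JE //.
  rewrite big_split /= sumr_const cardK -mulr_suml.
  rewrite (bigD1 i) //= eqxx big1; last first.
    by move=> j /andP[_ ji]; rewrite eq_sym (negbTE ji).
  over.
rewrite sumr_const cardK => <-; rewrite JE //.
rewrite -(mulr_natl (J l l / 2) d.+1) -(mulr_natl (_ + _) d.+1) /=.
have e2 : d.+2%:R = d.+1%:R + 1 :> R by rewrite -natr1.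
rewrite e2.
field.
by rewrite nat1r natr1 !pnatr_eq0.
Qed.

End simplex.

(** * Extreme eigenvalues of symmetric matrices *)

Section quadratic_forms.
Context {R : realType} {d : nat}.
Implicit Types (u v : 'rV[R]_d) (M : 'M[R]_d) (r : R).

Lemma bform_dotv M u v : bform M u v = dotv (u *m M) v.
Proof. by rewrite /bform mxE; apply: eq_bigr => k _; rewrite [v^T _ _]mxE. Qed.

Lemma bformDl M u v w : bform M (u + v) w = bform M u w + bform M v w.
Proof. by rewrite !bform_dotv mulmxDl dotvDl. Qed.

Lemma bformDr M u v w : bform M w (u + v) = bform M w u + bform M w v.
Proof. by rewrite !bform_dotv dotvDr. Qed.

Lemma bformZl M r u v : bform M (r *: u) v = r * bform M u v.
Proof. by rewrite !bform_dotv -scalemxAl dotvZl. Qed.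

Lemma bformZr M r u v : bform M u (r *: v) = r * bform M u v.
Proof. by rewrite !bform_dotv dotvZr. Qed.

Lemma bform0l M v : bform M 0 v = 0.
Proof. by rewrite bform_dotv mul0mx dotv0l. Qed.

Lemma bform0r M v : bform M v 0 = 0.
Proof. by rewrite bform_dotv dotv0. Qed.

Lemma bform_sumr (I : finType) (P : pred I) M u (v : I -> 'rV[R]_d) :
  bform M u (\sum_(i | P i) v i) = \sum_(i | P i) bform M u (v i).
Proof. by rewrite bform_dotv dotv_sumr; apply: eq_bigr => i _; rewrite bform_dotv. Qed.

Lemma bformE M u v : bform M u v = \sum_k \sum_l u 0 k * v 0 l * M k l.
Proof.
rewrite bform_dotv /dotv exchange_big /=; apply: eq_bigr => l _.
by rewrite mxE mulr_suml; apply: eq_bigr => k _; rewrite mulrAC.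
Qed.

Lemma bformC M u v : M^T = M -> bform M u v = bform M v u.
Proof.
move=> symM; rewrite !bformE exchange_big; apply: eq_bigr => k _.
by apply: eq_bigr => l _; rewrite -{1}symM mxE; ring.
Qed.

(** A crude bound suffices: it serves only to bound the Rayleigh quotients and the form of an
    inverse matrix. It rests on |u_k u_l| <= u . u. *)
Lemma bform_bound M u : bform M u u <= (\sum_k \sum_l `|M k l|) * dotv u u.
Proof.
have sq k : u 0 k ^+ 2 <= dotv u u.
  rewrite /dotv (bigD1 k) //= -expr2 lerDl.
  by apply: sumr_ge0 => i _; rewrite -expr2 sqr_ge0.
rewrite bformE mulr_suml; apply: ler_sum => k _.
rewrite mulr_suml; apply: ler_sum => l _.
apply: le_trans (ler_norm _) _; rewrite normrM mulrC; apply: ler_wpM2l => //.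
have := sq k; have := sq l; rewrite ler_norml.
have : 0 <= (u 0 k - u 0 l) ^+ 2 by exact: sqr_ge0.
have : 0 <= (u 0 k + u 0 l) ^+ 2 by exact: sqr_ge0.
by move=> h1 h2 h3 h4; apply/andP; split; nra.
Qed.

(** The form is nonnegative at every s u + t v; suitable s and t give the claim, also when the form
    is degenerate. *)
Lemma bform_Cauchy_Schwarz M u v : M^T = M -> (forall w, 0 <= bform M w w) ->
  bform M u v ^+ 2 <= bform M u u * bform M v v.
Proof.
move=> symM psdM.
have Q s t : 0 <= s ^+ 2 * bform M u u + 2 * s * t * bform M u v + t ^+ 2 * bform M v v.
  have := psdM (s *: u + t *: v).
  rewrite !(bformDl, bformDr, bformZl, bformZr) (bformC v u symM).
  by congr (0 <= _); ring.
have := psdM v; have := psdM u.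
move: Q; set p := bform M u u; set q := bform M v v; set b := bform M u v.
move=> Q p0; rewrite le_eqVlt => /orP[/eqP q0|q0].
  have [->|b0] := eqVneq b 0; first by rewrite expr0n /= -q0 mulr0.
  (* With q = 0 the form is affine in t at s = 1; this t would make it equal to -1. *)
  have := Q 1 (- (p + 1) / (2 * b)).
  rewrite -q0 (_ : _ + _ + _ = - 1); first by rewrite lerNr oppr0 ler10.
  by field.
(* This choice yields q (p q - b^2), and q is positive. *)
have := Q q (- b).
rewrite (_ : _ + _ + _ = q * (p * q - b ^+ 2)); last by ring.
by rewrite pmulr_rge0 // subr_ge0.
Qed.

Hypothesis d_gt0 : (0 < d)%N.

Let unit_vector : exists u : 'rV[R]_d, dotv u u = 1.
Proof.
case: d d_gt0 => // k _; exists (delta_mx 0 ord0).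
by rewrite dotv_delta mxE !eqxx.
Qed.

(** For symmetric [M] the infimum of this set is the least eigenvalue. *)
Let rayleigh M : set R := [set bform M u u | u in [set u | dotv u u = 1]].

Let rayleigh_inf M : has_inf (rayleigh M).
Proof.
split; first by have [u u1] := unit_vector; exists (bform M u u); exists u.
exists (- \sum_k \sum_l `|(- M) k l|) => _ [u /= u1 <-].
have := bform_bound (- M) u; rewrite u1 mulr1 lerNl.
by rewrite !bform_dotv mulmxN dotvNl.
Qed.

Let le_rayleigh M u : inf (rayleigh M) * dotv u u <= bform M u u.
Proof.
have [->|u0] := eqVneq u 0; first by rewrite dotv0 mulr0 bform0l.
have e0 := enorm_gt0 u0.
have : rayleigh M (bform M ((enorm u)^-1 *: u) ((enorm u)^-1 *: u)).
  exists ((enorm u)^-1 *: u) => //=.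
  by rewrite dotvZl dotvZr -sqr_enorm; field; rewrite gt_eqF.
move=> /(ge_inf (rayleigh_inf M).2); rewrite bformZl bformZr -sqr_enorm => h.
rewrite -ler_pdivlMr ?exprn_gt0 //; apply: le_trans h _.
by rewrite mulrA -expr2 mulrC exprVn.
Qed.

(* Otherwise A = M - m is invertible, and Cauchy-Schwarz for A bounds it below
   by 1 / C > 0 on the unit sphere, so that m is not the infimum. *)
Let eigenvalue_rayleigh M : M^T = M -> eigenvalue M (inf (rayleigh M)).
Proof.
move=> symM; set m := inf _; pose A := M - m%:M.
have symA : A^T = A by rewrite /A linearB /= symM tr_scalar_mx.
have bA u v : bform A u v = bform M u v - m * dotv u v.
  by rewrite !bform_dotv /A mulmxBr dotvBl mul_mx_scalar dotvZl.
have psdA w : 0 <= bform A w w by rewrite bA subr_ge0 le_rayleigh.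
apply: contrapT => noteig.
have Afree : row_free A.
  apply: inj_row_free => v vA; apply: contrapT => /eqP v0; apply: noteig.
  apply/eigenvalueP; exists v => //.
  by move: vA; rewrite /A mulmxBr mul_mx_scalar => /eqP; rewrite subr_eq0 => /eqP.
have Aunit : A \in unitmx by rewrite -row_free_unit.
pose B := invmx A; pose C := 1 + \sum_k \sum_l `|B k l|.
have C0 : 0 < C.
  by rewrite ltr_pwDl //; apply: sumr_ge0 => k _; apply: sumr_ge0.
(* As [B] inverts [A], Cauchy-Schwarz for [u *m B] and [u] reads 1 <= bform B u u * bform A u u, and
   the first factor is at most [C]. *)
have key u : dotv u u = 1 -> C^-1 <= bform A u u.
  move=> u1; have := bform_Cauchy_Schwarz (u *m B) u symA psdA.
  have uBA : u *m B *m A = u by rewrite mulmxKV.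
  rewrite {1}bform_dotv uBA u1 expr1n.
  rewrite {1}bform_dotv uBA dotvC -bform_dotv => h.
  have BC : bform B u u <= C.
    by apply: le_trans (bform_bound B u) _; rewrite u1 mulr1 lerDr.
  rewrite -[C^-1]mul1r ler_pdivrMr // mulrC; apply: le_trans h _.
  by apply: ler_wpM2r.
suff : m + C^-1 <= m by rewrite gerDl leNgt invr_gt0 C0.
apply: lb_le_inf; first exact: (rayleigh_inf M).1.
move=> _ [u /= u1 <-]; have := key u u1; rewrite bA u1 mulr1.
by rewrite lerBrDl.
Qed.

Let eigenvalue_ge M r : eigenvalue M r -> inf (rayleigh M) <= r.
Proof.
move=> /eigenvalueP[v vM v0].
have := le_rayleigh M v; rewrite bform_dotv vM dotvZl ler_pM2r //.
exact: dotv_gt0.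
Qed.

(** The infimum of the Rayleigh quotients is itself an eigenvalue, hence at least [eig_min M]. *)
Lemma eig_min_le M u : M^T = M -> eig_min M * dotv u u <= bform M u u.
Proof.
move=> symM; apply: le_trans (le_rayleigh M u); apply: ler_wpM2r (dotv_ge0 u) _ _ _.
apply: ge_inf; last exact: eigenvalue_rayleigh.
by exists (inf (rayleigh M)) => r; exact: eigenvalue_ge.
Qed.

Lemma eig_min_ge0 M : M^T = M -> (forall w, 0 <= bform M w w) -> 0 <= eig_min M.
Proof.
move=> symM psdM; apply: lb_le_inf.
  by exists (inf (rayleigh M)); exact: eigenvalue_rayleigh.
move=> r /eigenvalueP[v vM v0]; have := psdM v.
by rewrite bform_dotv vM dotvZl pmulr_lge0 // dotv_gt0.
Qed.

End quadratic_forms.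

Lemma eig_max_ge (R : realType) (d : nat) (M : 'M[R]_d) (u : 'rV[R]_d) :
  (0 < d)%N -> M^T = M -> bform M u u <= eig_max M * dotv u u.
Proof.
move=> d0 symM.
have symN : (- M)^T = - M by rewrite linearN /= symM.
have := eig_min_le d0 u symN.
rewrite [X in _ <= X]bform_dotv mulmxN dotvNl -bform_dotv lerNr -mulNr.
suff -> : - eig_min (- M) = eig_max M by [].
(* [inf] unfolds to minus the [sup] of the opposite set, so it remains to see that the spectrum of
   [- M] is the opposite of that of [M]. *)
rewrite /eig_min /eig_max /inf opprK; congr sup; apply/seteqP; split => r.
  move=> [s /eigenvalueP[v vM v0] <-]; apply/eigenvalueP; exists v => //.
  by rewrite scaleNr -vM mulmxN opprK.
move=> /eigenvalueP[v vM v0]; exists (- r); last by rewrite opprK.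
by apply/eigenvalueP; exists v => //; rewrite mulmxN vM scaleNr.
Qed.

(** * Gradients of the nodal basis *)

Section affine_functions.
Context {R : realType} {d : nat}.
Implicit Types (x v : 'rV[R]_d) (c : R).

Lemma continuous_affine c v : continuous (fun x => c + dotv v x).
Proof.
have cdot : continuous (dotv v).
  apply: continuous_big => [|k _]; first exact: add_continuous.
  move=> y; apply: (@continuousM _ _ (fun=> v 0 k) (fun z : 'rV[R]_d => z 0 k)).
    exact: cst_continuous.
  exact: coord_continuous.
move=> x; apply: (@continuousD _ _ _ (fun=> c) (dotv v)); last exact: cdot.
exact: cst_continuous.
Qed.

Lemma grad_near_affine (F : 'rV[R]_d -> R) c v x :
  (\forall y \near x, F y = c + dotv v y) -> grad F x = v.
Proof.
move=> Fx; apply/rowP => k; rewrite mxE (near_eq_derive _ Fx) /derive.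
apply: cvg_lim => //; apply: cvg_near_cst; near=> h => /=.
rewrite dotvDr dotvZr dotv_delta.
rewrite (_ : _ - _ = h * v 0 k); last by ring.
rewrite /GRing.scale /= mulKf //.
near: h; exact: nbhs_dnbhs_neq.
Unshelve. all: by end_near. Qed.

End affine_functions.

Section simplex_gradient.
Context {R : realType} {d : nat} {Th : mesh R d}.
Local Notation nvtx := (nint Th + nbnd Th)%N.
Local Notation a := (@vertex _ _ Th).
Variable (K : {set 'I_nvtx}).
Hypotheses (d_gt0 : (0 < d)%N) (cardK : #|K| = d.+1).
Hypothesis affK : affinely_independent a K.
Variables (c : 'I_nvtx -> R) (w : 'I_nvtx -> 'rV[R]_d).
Hypothesis bary_vertex : forall i j, i \in K -> j \in K ->
  c j + dotv (w j) (a i) = (i == j)%:R.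
Local Notation lam := (bary c w).

Lemma open_simplex_nbhs x : open_simplex K c w x ->
  \forall y \near x, open_simplex K c w y.
Proof.
move=> xK.
apply: (@filter_forall _ _ (fun j y => j \in K -> 0 < lam j y) (nbhs x)) => j.
have [jK|jNK] := boolP (j \in K); last by near=> y.
near=> y; move=> _; near: y.
exact: (@cvgr_gt R _ (nbhs x) _ _ _ (@continuous_affine R d (c j) (w j) x) 0 (xK j jK)).
Unshelve. all: by end_near. Qed.

Lemma barycenter_open_simplex : open_simplex K c w (barycenter a K).
Proof.
by move=> j jK; rewrite (bary_barycenter cardK bary_vertex) // invr_gt0.
Qed.

(** The barycenter has a neighborhood inside the cell, so the values of [F] outside the cell do not
    affect the gradient. *)
Lemma grad_barycenter (F : 'rV[R]_d -> R) (c0 : R) v :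
  (forall x, conv_hull a K x -> F x = c0 + dotv v x) ->
  grad F (barycenter a K) = v.
Proof.
move=> FK; apply: (@grad_near_affine _ _ _ c0).
near=> y; apply: FK.
apply: (open_simplex_sub cardK affK bary_vertex).
near: y; exact/open_simplex_nbhs/barycenter_open_simplex.
Unshelve. all: by end_near. Qed.

Variable i : 'I_nvtx.
Hypothesis iK : i \in K.

Let wi0 : w i != 0. Proof. exact: (bary_grad_neq0 cardK bary_vertex). Qed.

Let ni0 : 0 < enorm (w i). Proof. exact: enorm_gt0 wi0. Qed.

Lemma face_normalE : face_normal K i = (enorm (w i))^-1 *: w i.
Proof.
have edge := dotv_edge bary_vertex.
apply: xget_unique.
  split.
  - by rewrite enormZ normfV (ger0_norm (ltW ni0)) mulVf // gt_eqF.
  - move=> j k; rewrite !inE => /andP[ji jK] /andP[ki kK].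
    by rewrite dotvZl edge // (negbTE ji) (negbTE ki) subr0 mulr0.
  - move=> j; rewrite !inE => /andP[ji jK].
    by rewrite dotvZl edge // eqxx (negbTE ji) subr0 mulr1 invr_gt0.
(* [face_normal] is a choice, so uniqueness is required: [v] minus its expected multiple of [w i] is
   orthogonal to all edges, hence 0, and the unit norm fixes the multiple. *)
move=> v [v1 vedge vpos].
have [k kK ki] := exists_other_vertex cardK d_gt0 iK.
have kKi : k \in K :\ i by rewrite !inE ki.
pose s := dotv v (a i - a k); have s0 : 0 < s by exact: vpos.
pose z := v - s *: w i.
have zedge j : j \in K -> dotv z (a j - a k) = 0.
  move=> jK; rewrite /z dotvBl dotvZl edge // (negbTE ki) subr0.
  have [->|ji] := eqVneq j i; first by rewrite mulr1 subrr.
  have -> : dotv v (a j - a k) = 0 by apply: vedge => //; rewrite !inE ji.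
  by rewrite /= mulr0 subrr.
have z0 : z = 0.
  apply/eqP; rewrite -dotv_eq0; apply/eqP.
  have zE := baryE cardK affK bary_vertex (a k + z).
  have z1 := sum_bary cardK affK bary_vertex (a k + z).
  (* [z] is a combination of the edges from [a k], hence orthogonal to itself. *)
  rewrite {2}(_ : z = \sum_(j in K) lam j (a k + z) *: (a j - a k)).
    by rewrite dotv_sumr big1 // => j jK; rewrite dotvZr zedge // mulr0.
  under eq_bigr do rewrite scalerBr.
  by rewrite sumrB -zE -scaler_suml z1 scale1r addrC addKr.
have vE : v = s *: w i by apply/eqP; rewrite -subr_eq0 -/z z0.
have : s * enorm (w i) = 1 by rewrite -v1 vE enormZ gtr0_norm.
by move=> /(canRL (mulfK (lt0r_neq0 ni0))); rewrite mul1r vE => ->.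
Qed.

Lemma dotv_Cauchy_Schwarz (u v : 'rV[R]_d) : dotv u v <= enorm u * enorm v.
Proof.
have b1 x y : bform 1%:M x y = dotv x y :> R by rewrite bform_dotv mulmx1.
have := @bform_Cauchy_Schwarz R d 1%:M u v (trmx1 _ _).
rewrite !b1 => h; rewrite -sqrtrM ?dotv_ge0 //.
apply: le_trans (ler_norm _) _; rewrite -sqrtr_sqr ler_sqrt ?h // => [w'|].
  by rewrite b1 dotv_ge0.
by rewrite mulr_ge0 ?dotv_ge0.
Qed.

(** On the hyperplane of the face, w_i . (a_i - y) = 1, so Cauchy-Schwarz bounds the distance below;
    the foot of the perpendicular attains the bound. *)
Lemma heightE : height K i = (enorm (w i))^-1.
Proof.
have bary_face y : affine_hull a (K :\ i) y -> lam i y = 0.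
  move=> [m [m1 ->]]; pose m' j := if j == i then 0 else m j.
  have mE (V : lmodType R) (f : 'I_nvtx -> V) :
      \sum_(j in K :\ i) m j *: f j = \sum_(j in K) m' j *: f j.
    rewrite [RHS](big_setD1 i) //= {1}/m' eqxx scale0r add0r.
    by apply: eq_bigr => j; rewrite !inE /m' => /andP[/negbTE ->].
  rewrite mE (bary_comb bary_vertex) // /m' ?eqxx //.
  (* The same identity with a constant function shows that the weights [m'] sum to 1. *)
  have := mE R^o (fun=> 1); rewrite /GRing.scale /=.
  under eq_bigr do rewrite mulr1; under [RHS]eq_bigr do rewrite mulr1.
  by rewrite m1.
have dist y : affine_hull a (K :\ i) y -> dotv (w i) (a i - y) = 1.
  move=> /bary_face h; have := bary_vertex iK iK; rewrite eqxx /= => e.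
  by move: h; rewrite dotvBr /bary; lra.
(* The foot of the perpendicular from [a i]. *)
pose y0 := a i - (dotv (w i) (w i))^-1 *: w i.
have y0w : lam i y0 = 0.
  rewrite baryD dotvNr dotvZr mulVf ?dotv_eq0 //.
  by rewrite [lam i (a i)]bary_vertex // eqxx subrr.
have y0K : affine_hull a (K :\ i) y0.
  exists (lam^~ y0); split.
    by rewrite -(sum_bary cardK affK bary_vertex y0) (big_setD1 i iK) /= y0w add0r.
  rewrite {1}(baryE cardK affK bary_vertex y0) (big_setD1 i iK) /= y0w.
  by rewrite scale0r add0r.
apply/eqP; rewrite eq_le; apply/andP; split.
  rewrite [leRHS](_ : _ = enorm (a i - y0)).
    apply: ge_inf; last by exists y0.
    by exists 0 => _ [y _ <-]; exact: enorm_ge0.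
  rewrite /y0 opprB addrC subrK enormZ -sqr_enorm ger0_norm; last first.
    by rewrite invr_ge0 exprn_ge0 // enorm_ge0.
  by field; rewrite gt_eqF.
apply: lb_le_inf; first by exists (enorm (a i - y0)); exists y0.
move=> _ [y yK <-]; rewrite -[leLHS]mul1r ler_pdivrMr // mulrC.
by rewrite -(dist y yK); exact: dotv_Cauchy_Schwarz.
Qed.

(** This links the geometric data of the angle and time step conditions to the gradients in the
    stiffness matrix. *)
Lemma qvecE : qvec K i = w i.
Proof. by rewrite /qvec heightE face_normalE invrK scalerA mulfV ?scale1r // gt_eqF. Qed.

End simplex_gradient.

(** * Basis functions, load and mean diffusion matrix on one cell *)

Section cells.
Context {R : realType} {d : nat} {Th : mesh R d} {Omega : set 'rV[R]_d}.
Variables (phi : 'I_(nint Th + nbnd Th) -> 'rV[R]_d -> R) (D : 'rV[R]_d -> 'M[R]_d).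
Local Notation nvtx := (nint Th + nbnd Th)%N.
Local Notation a := (@vertex _ _ Th).
Hypotheses (d_gt0 : (0 < d)%N) (interior_closure : (closure Omega)° = Omega).
Hypotheses (triTh : triangulation_of Th Omega) (basis_phi : nodal_basis Omega phi).

Implicit Types K : {set 'I_nvtx}.

Let card_cell K : K \in cells Th -> #|K| = d.+1.
Proof. by case: triTh => h _ _ _ _ /h[]. Qed.

Let affine_cell K : K \in cells Th -> affinely_independent a K.
Proof. by case: triTh => h _ _ _ _ /h[]. Qed.

Lemma vertex_cell K i : i \in K -> cell K (a i).
Proof.
move=> iK; exists (fun j => (j == i)%:R); split.
- by move=> j _; rewrite ler0n.
- by rewrite (bigD1 i) //= eqxx big1 ?addr0 // => j /andP[_ /negbTE ->].
- rewrite (bigD1 i) //= eqxx scale1r big1 ?addr0 // => j /andP[_ /negbTE ->].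
  by rewrite scale0r.
Qed.

(** A basis function of a vertex outside [K] vanishes at all vertices of [K], hence on the cell; its
    data are set to 0, so that sums over all nodes reduce to sums over [K]. *)
Lemma cell_affine K : K \in cells Th ->
  exists (c : 'I_nvtx -> R) (w : 'I_nvtx -> 'rV[R]_d),
  [/\ forall j x, cell K x -> phi j x = bary c w j x,
      forall i j, i \in K -> j \in K -> c j + dotv (w j) (a i) = (i == j)%:R &
      forall j, j \notin K -> c j = 0 /\ w j = 0].
Proof.
move=> Kc.
have /choice[cw cwE] : forall j, exists p : R * 'rV[R]_d,
    (forall x, cell K x -> phi j x = p.1 + dotv p.2 x) /\
    (j \notin K -> p = (0, 0)).
  move=> j; have [_ /(_ K Kc)[c [v phiE]] phi_node] := basis_phi j.
  have [jK|jK] := boolP (j \in K); first by exists (c, v).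
  exists (0, 0); split => // x xK; rewrite dotv0l addr0 phiE //.
  have [m [_ m1 ->]] := xK.
  rewrite dotv_sumr -[c]mulr1 -m1 mulr_sumr -big_split /= big1 // => i iK.
  rewrite dotvZr mulrC -mulrDr -phiE ?phi_node; last exact: vertex_cell.
  by rewrite (negbTE (memPn jK i iK)) mulr0.
exists (fun j => (cw j).1), (fun j => (cw j).2); split.
- by move=> j x; exact: (cwE j).1.
- move=> i j iK jK; rewrite -(cwE j).1; last exact: vertex_cell.
  by have [_ _ ->] := basis_phi j.
- by move=> j /(cwE j).2 ->.
Qed.

Variables (K : {set 'I_nvtx}) (c : 'I_nvtx -> R) (w : 'I_nvtx -> 'rV[R]_d).
Hypothesis Kc : K \in cells Th.
Hypothesis phiE : forall j x, cell K x -> phi j x = bary c w j x.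
Hypothesis bary_vertex : forall i j, i \in K -> j \in K ->
  c j + dotv (w j) (a i) = (i == j)%:R.
Hypothesis bary_out : forall j, j \notin K -> c j = 0 /\ w j = 0.

Local Notation P := (@point_of R d @^-1` cell K).

Let cardK := card_cell Kc.
Let affK := affine_cell Kc.

(** The open simplex is an open subset of the closure of [Omega], hence lies in the interior of that
    closure. The data have their signs only in [Omega], so cells must be entered this way. *)
Lemma open_simplex_domain : open_simplex K c w `<=` Omega.
Proof.
rewrite -interior_closure => x xK; have [_ -> _ _ _] := triTh.
apply: (filterS (P := open_simplex K c w)); last exact: open_simplex_nbhs xK.
by move=> y /(open_simplex_sub cardK affK bary_vertex) yK; exists K.
Qed.

Lemma volume_cell_gt0 : 0 < volume (cell K).
Proof.
rewrite /volume fine_gt0 // (leb_simplex_gt0 cardK affK bary_vertex).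
exact: (leb_simplex_lty cardK affK bary_vertex).
Qed.

Lemma measurable_cell : measurable P.
Proof. exact: (measurable_simplex cardK affK bary_vertex). Qed.

(** The faces form a null set, so the integral may be restricted to the open simplex, which lies in
    [Omega]. *)
Lemma integral_on_cell_ge0 (F : 'rV[R]_d -> R) : integrable_on (cell K) F ->
  (forall x, Omega x -> cell K x -> 0 <= F x) -> 0 <= integral_on (cell K) F.
Proof.
move=> iF F0; rewrite /integral_on /Rintegral fine_ge0 //.
have mo := @measurable_open_simplex R d _ K c w.
rewrite (negligible_integral _ measurable_cell iF
  (leb_simplex_boundary cardK affK bary_vertex d_gt0)); last first.
  by apply: measurableD => //; exact: measurable_cell.
apply: integral_ge0 => t [tK /= tN]; rewrite lee_fin; apply: F0 => //.
apply: open_simplex_domain; apply: contrapT => h; apply: tN; split => //.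
Qed.

Lemma cell_gradE j : cell_grad phi K j = w j.
Proof.
apply: (grad_barycenter cardK affK bary_vertex (c0 := c j)) => x xK.
exact: phiE.
Qed.

Lemma integral_phi_mul i j : integral_on (cell K) (fun x => phi j x * phi i x) =
  ((i \in K) && (j \in K))%:R * (1 + (i == j)%:R) * volume (cell K) /
    (d.+1%:R * d.+2%:R).
Proof.
have E : integral_on (cell K) (fun x => phi j x * phi i x) =
    integral_on (cell K) (fun x => bary c w j x * bary c w i x).
  by apply: eq_Rintegral => t; rewrite inE /= => tK; rewrite !phiE.
have [/andP[iK jK]|h] := boolP ((i \in K) && (j \in K)).
  by rewrite E (integral_bary_mul cardK affK bary_vertex) // mul1r eq_sym.
rewrite !mul0r E /integral_on.
rewrite (@eq_Rintegral _ _ _ _ _ (cst 0)).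
  by rewrite Rintegral_cst ?mul0r //; exact: measurable_cell.
move=> t _ /=; move: h; rewrite negb_and => /orP[] /bary_out[c0 w0].
  by rewrite {2}/bary c0 w0 dotv0l addr0 mulr0.
by rewrite {1}/bary c0 w0 dotv0l addr0 mul0r.
Qed.

Lemma phi_ge0 j x : cell K x -> 0 <= phi j x.
Proof.
move=> xK; rewrite phiE //; have [jK|/bary_out[c0 w0]] := boolP (j \in K).
  by move: xK; rewrite [cell K](conv_hull_bary cardK affK bary_vertex); exact.
by rewrite /bary c0 w0 dotv0l addr0.
Qed.

Lemma phi_le1 j x : cell K x -> phi j x <= 1.
Proof.
move=> xK; rewrite phiE //; have [jK|/bary_out[c0 w0]] := boolP (j \in K).
  exact: (bary_le1 cardK affK bary_vertex).
by rewrite /bary c0 w0 dotv0l addr0 ler01.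
Qed.

Lemma sum_phi x : cell K x -> \sum_j phi j x = 1.
Proof.
move=> xK; rewrite -(sum_bary cardK affK bary_vertex x).
rewrite (bigID (mem K)) /= [X in _ + X]big1 ?addr0.
  by apply: eq_bigr => j _; exact: phiE.
by move=> j /bary_out[c0 w0]; rewrite phiE // /bary c0 w0 dotv0l addr0.
Qed.

Lemma sum_cell_grad : \sum_j w j = 0.
Proof.
rewrite -[RHS](sum_bary_grad cardK affK bary_vertex) [LHS](bigID (mem K)) /=.
by rewrite [X in _ + X]big1 ?addr0 // => j /bary_out[].
Qed.

Lemma load_cell_le0 (f : 'rV[R]_d -> R) i : integrable_on (cell K) f ->
  (forall x, Omega x -> f x <= 0) ->
  integral_on (cell K) (fun x => f x * phi i x) <= 0.
Proof.
move=> intf f0.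
have mb : measurable_fun [set: d.-tuple (measurableTypeR R)]
    (fun t => - bary c w i (point_of t)).
  by apply: measurableT_comp => //; exact: measurable_bary.
have mP := measurable_cell.
(* On the cell this is - f phi_i; the affine formula gives measurability, and |f| dominates. *)
pose F x := f x * - bary c w i x.
have intF : integrable_on (cell K) F.
  apply: (le_integrable mP _ _ intf).
    apply/measurable_EFinP; apply: measurable_funM; last exact: measurable_funTS.
    by apply/measurable_EFinP; exact: measurable_int intf.
  move=> t /= tK; rewrite lee_fin /F normrM normrN -phiE // ler_piMr //.
  by rewrite ger0_norm ?phi_ge0 // phi_le1.
have := integral_on_cell_ge0 intF.
have -> : integral_on (cell K) F = - integral_on (cell K) (fun x => f x * phi i x).
  rewrite -mulN1r /integral_on -RintegralZl //.
    by apply: eq_Rintegral => t; rewrite inE /= => tK; rewrite /F phiE //; ring.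
  have := integrableZl mP (-1) intF; apply: eq_integrable => // t.
  by rewrite inE /= => tK; rewrite /F phiE // -EFinM; congr _%:E; ring.
rewrite oppr_ge0; apply => x xO xK.
by rewrite /F -phiE // mulrN -mulNr mulr_ge0 ?oppr_ge0 ?f0 // phi_ge0.
Qed.

Hypothesis symD : forall x, Omega x -> (D x)^T = D x.
Hypothesis posD : forall x, Omega x -> forall v : 'rV[R]_d, v != 0 -> 0 < bform (D x) v v.
Hypothesis intD : forall k l : 'I_d, integrable_on (cell K) (fun x => D x k l).

(** Symmetry of [D] holds on [Omega] only, so each of the two inequalities between integrals goes
    through [integral_on_cell_ge0]. *)
Lemma mean_mx_sym : (mean_mx D K)^T = mean_mx D K.
Proof.
have le k l : integral_on (cell K) (fun x => D x k l) <=
    integral_on (cell K) (fun x => D x l k).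
  rewrite -subr_ge0 /integral_on -(RintegralB measurable_cell (intD l k) (intD k l)).
  apply: (integral_on_cell_ge0 (F := fun x => D x l k - D x k l)).
    exact: (integrableB measurable_cell (intD l k) (intD k l)).
  move=> x xO _; rewrite subr_ge0 -{1}(symD xO) mxE //.
apply/matrixP => k l; rewrite !mxE; congr (_ * _).
by apply/eqP; rewrite eq_le !le.
Qed.

(** For fixed [v] the quadratic form is linear in the matrix, so its value at the mean is the mean
    of its values. *)
Lemma mean_mx_psd (v : 'rV[R]_d) : 0 <= bform (mean_mx D K) v v.
Proof.
have mP := measurable_cell.
have intZ k l : (leb d).-integrable P
    (EFin \o (fun t => v 0 k * v 0 l * D (point_of t) k l)).
  exact: (integrableZl mP (v 0 k * v 0 l) (intD k l)).
have S1 k := Rintegral_sum mP (P := xpredT) (fun l _ => intZ k l).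
have [S2i S2] := Rintegral_sum mP (P := xpredT) (fun k _ => (S1 k).1).
have -> : bform (mean_mx D K) v v =
    (volume (cell K))^-1 * integral_on (cell K) (fun x => bform (D x) v v).
  rewrite bformE.
  rewrite [integral_on _ _](_ : _ = \int[leb d]_(t in P)
      \sum_k \sum_l v 0 k * v 0 l * D (point_of t) k l); last first.
    by apply: eq_Rintegral => t _; rewrite bformE.
  rewrite S2 mulr_sumr; apply: eq_bigr => k _.
  rewrite (S1 k).2 mulr_sumr; apply: eq_bigr => l _.
  by rewrite (RintegralZl _ mP (intD k l)) /mean_mx !mxE /integral_on; ring.
apply: mulr_ge0; first by rewrite invr_ge0 ltW // volume_cell_gt0.
apply: integral_on_cell_ge0.
  apply: eq_integrable S2i => // t _ /=.
  by rewrite bformE.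
move=> x xO _; have [->|v0] := eqVneq v 0; first by rewrite bform0l.
exact/ltW/posD.
Qed.

End cells.

(** * Element matrices *)

Section time_steps.
Context {R : realType} {d : nat} {Th : mesh R d}.
Variables (D : 'rV[R]_d -> 'M[R]_d) (theta dt : R).
Local Notation nvtx := (nint Th + nbnd Th)%N.
Variables (K : {set 'I_nvtx}) (i : 'I_nvtx).
Hypotheses (Kc : K \in cells Th) (iK : i \in K).

Lemma le_time_step_lower (j : 'I_nvtx) :
  let X := cos (metric_angle D K i j) * eig_min (mean_mx D K) in
  0 < theta -> j \in K -> j != i -> 0 < height K i * height K j -> 0 <= X ->
  (time_step_lower Th D theta <= dt%:E)%E ->
  0 < X /\ height K i * height K j <= dt * (theta * d.+1%:R * d.+2%:R) * X.
Proof.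
move=> X theta0 jK ji h0 X0 lowdt.
have e0 : 0 < theta * d.+1%:R * d.+2%:R by rewrite !mulr_gt0.
pose t : \bar R := ((height K i * height K j)%:E / X%:E)%E.
have : (((theta * d.+1%:R * d.+2%:R)^-1)%:E * t <= dt%:E)%E.
  apply: le_trans lowdt; rewrite /time_step_lower div1e inver gt_eqF //.
  rewrite lee_pmul2l ?fin_numE // ?lte_fin ?invr_gt0 //.
  apply: le_trans (le_bigmax_cond _ _ Kc).
  apply: le_trans (le_bigmax_cond _ _ iK).
  apply: le_trans (le_bigmax_cond _ _ _); last by apply/andP; split; [exact: jK|exact: ji].
  by [].
rewrite /t inver; have [XE|XN] := eqVneq X 0.
  (* With [X] zero the quotient is +oo, which no finite [dt] bounds. *)
  by rewrite mulr_infty gtr0_sg // mul1e mulr_infty gtr0_sg ?invr_gt0 // mul1e.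
have Xp : 0 < X by rewrite lt_neqAle eq_sym XN.
rewrite -!EFinM lee_fin => h; split => //.
by rewrite -ler_pdivrMr // -ler_pdivrMr // mulrC.
Qed.

(** The two strict hypotheses make both denominators positive, hence the extended-real quotients
    finite. *)
Lemma le_time_step_upper : theta < 1 -> 0 < eig_max (mean_mx D K) ->
  (dt%:E <= time_step_upper Th D theta)%E ->
  dt * ((1 - theta) * d.+1%:R * d.+2%:R) * eig_max (mean_mx D K) <= 2 * height K i ^+ 2.
Proof.
move=> theta1 l0 updt.
have e0 : 0 < (1 - theta) * d.+1%:R * d.+2%:R by rewrite !mulr_gt0 // subr_gt0.
have : (dt%:E <= (2 / ((1 - theta) * d.+1%:R * d.+2%:R))%:E *
    (height K i ^+ 2 / eig_max (mean_mx D K))%:E)%E.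
  apply: le_trans updt _; rewrite /time_step_upper inver gt_eqF // -EFinM.
  rewrite lee_pmul2l ?fin_numE // ?lte_fin ?divr_gt0 //.
  apply: le_trans (bigmin_le_cond _ _ Kc) _.
  apply: le_trans (bigmin_le_cond _ _ iK) _.
  by rewrite inver gt_eqF.
rewrite -EFinM lee_fin => h.
rewrite -ler_pdivlMr // -ler_pdivlMr //; apply: le_trans h _.
rewrite le_eqVlt; apply/orP; left; apply/eqP; field.
by rewrite (gt_eqF l0) -natrD nat1r !pnatr_eq0 /= subr_eq0 gt_eqF.
Qed.

End time_steps.

Section element_matrices.
Context {R : realType} {d : nat} {Th : mesh R d} {Omega : set 'rV[R]_d}.
Variables (phi : 'I_(nint Th + nbnd Th) -> 'rV[R]_d -> R) (D : 'rV[R]_d -> 'M[R]_d).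
Variables (theta dt : R).
Local Notation nvtx := (nint Th + nbnd Th)%N.
Local Notation a := (@vertex _ _ Th).
Hypotheses (d_gt0 : (0 < d)%N) (interior_closure : (closure Omega)° = Omega).
Hypotheses (triTh : triangulation_of Th Omega) (basis_phi : nodal_basis Omega phi).
Hypothesis symD : forall x, Omega x -> (D x)^T = D x.
Hypothesis posD : forall x, Omega x -> forall v : 'rV[R]_d, v != 0 -> 0 < bform (D x) v v.
Variable K : {set 'I_nvtx}.
Hypothesis Kc : K \in cells Th.
Hypothesis intD : forall k l : 'I_d, integrable_on (cell K) (fun x => D x k l).

Definition cell_mass i j : R := integral_on (cell K) (fun x => phi j x * phi i x).

Definition cell_stiff i j : R :=
  volume (cell K) * bform (mean_mx D K) (cell_grad phi K i) (cell_grad phi K j).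

Local Notation M := (mean_mx D K).

(** The gradients of the basis functions sum to 0 on the cell. *)
Lemma cell_stiff_sum i : \sum_j cell_stiff i j = 0.
Proof.
have [c [w [phiE bv bo]]] := cell_affine basis_phi Kc.
rewrite /cell_stiff -mulr_sumr -bform_sumr.
under eq_bigr do rewrite (cell_gradE triTh Kc phiE bv).
by rewrite (sum_cell_grad triTh Kc bv bo) bform0r mulr0.
Qed.

Lemma cell_mass_ge0 i j : 0 <= cell_mass i j.
Proof.
have [c [w [phiE bv bo]]] := cell_affine basis_phi Kc.
apply: Rintegral_ge0 => t tK.
by rewrite mulr_ge0 // (phi_ge0 triTh Kc phiE bv bo).
Qed.

Lemma cell_mass_diag_gt0 i : i \in K -> 0 < cell_mass i i.
Proof.
move=> iK; have [c [w [phiE bv bo]]] := cell_affine basis_phi Kc.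
rewrite /cell_mass (integral_phi_mul triTh Kc phiE bv bo) iK eqxx.
have V0 := volume_cell_gt0 triTh Kc bv.
by rewrite divr_gt0 // !mulr_gt0 // addr_gt0.
Qed.

Hypothesis nonobtuse : forall i j, i \in K -> j \in K -> i != j ->
  0 < metric_angle D K i j <= pi / 2.

(** Cauchy-Schwarz puts the argument of [acos] in [-1, 1], so [cos] undoes it; the angle bound then
    gives the sign of q. *)
Lemma cell_cosE i j : i \in K -> j \in K -> i != j ->
  let q := bform M (qvec K i) (qvec K j) in
  [/\ 0 <= cos (metric_angle D K i j),
      cos (metric_angle D K i j) = - (q / (dnorm M (qvec K i) * dnorm M (qvec K j))) &
      q <= 0].
Proof.
move=> iK jK ij q.
have [c [w [phiE bv bo]]] := cell_affine basis_phi Kc.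
have symM := mean_mx_sym d_gt0 interior_closure triTh Kc bv symD intD.
have psdM := mean_mx_psd d_gt0 interior_closure triTh Kc bv posD intD.
have ang := nonobtuse iK jK ij.
set m := dnorm M (qvec K i); set n := dnorm M (qvec K j).
have m0 : 0 <= m by exact: sqrtr_ge0.
have n0 : 0 <= n by exact: sqrtr_ge0.
have CS : `|q| <= m * n.
  rewrite -sqrtrM ?psdM // -sqrtr_sqr ler_sqrt ?mulr_ge0 ?psdM //.
  exact: bform_Cauchy_Schwarz.
have cosE : cos (metric_angle D K i j) = - (q / (m * n)).
  rewrite /metric_angle -/q -/m -/n acosK // in_itv /= -ler_norml normrN normrM normfV.
  (* The mean matrix is only known to be semidefinite here; a zero denominator makes the quotient
     0. *)
  have [->|mn0] := eqVneq (m * n) 0; first by rewrite normr0 invr0 mulr0 ler01.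
  have mn1 : 0 < m * n by rewrite lt_neqAle eq_sym mn0 mulr_ge0.
  by rewrite (gtr0_norm mn1) ler_pdivrMr // mul1r.
have cos0 : 0 <= cos (metric_angle D K i j).
  apply: cos_ge0_pihalf; have /andP[h1 ->] := ang; rewrite andbT.
  by apply: le_trans (ltW h1); rewrite oppr_le0 divr_ge0 // pi_ge0.
split => //; move: cos0; rewrite cosE oppr_ge0.
have [mn0 _|mn0] := eqVneq (m * n) 0.
  by move: CS; rewrite mn0 normr_le0 => /eqP ->.
have mn1 : 0 < m * n by rewrite lt_neqAle eq_sym mn0 mulr_ge0.
by rewrite ler_pdivrMr // mul0r.
Qed.

Hypothesis theta01 : 0 < theta <= 1.
Hypothesis dt0 : 0 < dt.

Lemma cell_offdiag_le0 i j : i != j ->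
  (time_step_lower Th D theta <= dt%:E)%E ->
  cell_mass i j + theta * dt * cell_stiff i j <= 0.
Proof.
move=> ij lowdt.
have [c [w [phiE bv bo]]] := cell_affine basis_phi Kc.
rewrite /cell_mass (integral_phi_mul triTh Kc phiE bv bo) /cell_stiff.
rewrite !(cell_gradE triTh Kc phiE bv).
have [/andP[iK jK]|] := boolP ((i \in K) && (j \in K)); last first.
  rewrite negb_and !mul0r add0r => /orP[] /bo[_ ->].
    by rewrite bform0l !mulr0.
  by rewrite bform0r !mulr0.
have V0 := volume_cell_gt0 triTh Kc bv.
have symM := mean_mx_sym d_gt0 interior_closure triTh Kc bv symD intD.
have psdM := mean_mx_psd d_gt0 interior_closure triTh Kc bv posD intD.
have [theta0 _] := andP theta01.
have cardK : #|K| = d.+1 by case: triTh => h _ _ _ _; case: (h K Kc).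
have affK : affinely_independent a K by case: triTh => h _ _ _ _; case: (h K Kc).
have [cos0 cosE q0] := cell_cosE iK jK ij.
have hE k kK := @heightE _ _ _ _ d_gt0 cardK affK c w bv k kK.
have qE k kK := @qvecE _ _ _ _ d_gt0 cardK affK c w bv k kK.
rewrite !qE // in cosE q0.
have nw k : k \in K -> 0 < enorm (w k).
  by move=> kK; apply: enorm_gt0; exact: (bary_grad_neq0 cardK bv).
have lmin0 := eig_min_ge0 d_gt0 symM psdM.
have hh0 : 0 < height K i * height K j by rewrite !hE // mulr_gt0 ?invr_gt0 ?nw.
have ji : j != i by rewrite eq_sym.
have [X0 hX] := le_time_step_lower Kc iK theta0 jK ji hh0 (mulr_ge0 cos0 lmin0) lowdt.
set q := bform M (w i) (w j) in cosE q0 *.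
set C := cos _ in cosE cos0 X0 hX; set l := eig_min M in lmin0 X0 hX.
(* The eigenvalue bound compares the norm in the metric of the mean matrix with the Euclidean
   one. *)
have dn k : k \in K -> Num.sqrt l * enorm (w k) <= dnorm M (w k).
  move=> kK; rewrite -[enorm _]gtr0_norm ?nw // -sqrtr_sqr -sqrtrM // sqr_enorm.
  by rewrite ler_sqrt ?psdM //; exact: eig_min_le.
set m := dnorm M (w i) in cosE; set n := dnorm M (w j) in cosE.
have lmn : l * (enorm (w i) * enorm (w j)) <= m * n.
  have -> : l * (enorm (w i) * enorm (w j)) =
      (Num.sqrt l * enorm (w i)) * (Num.sqrt l * enorm (w j)).
    by rewrite mulrACA -expr2 sqr_sqrtr.
  by apply: ler_pM; rewrite ?mulr_ge0 ?sqrtr_ge0 ?enorm_ge0 ?dn.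
have C0 : 0 < C.
  by rewrite lt_neqAle cos0 andbT; apply/eqP => C0; move: X0; rewrite -C0 mul0r ltxx.
have mn0 : m * n != 0.
  by apply/eqP => mn0; move: C0; rewrite cosE mn0 invr0 mulr0 oppr0 ltxx.
have qC : - q = C * (m * n) by rewrite cosE mulNr divfK.
have ee : 0 < enorm (w i) * enorm (w j) by rewrite mulr_gt0 ?nw.
(* Heights are inverses of gradient norms, so the lower bound on [dt] concerns C l |w_i| |w_j|,
   which is at most - q by [lmn] and [qC]. *)
have hX' : 1 <= dt * theta * (d.+1%:R * d.+2%:R) * (- q).
  move: hX; rewrite !hE // -invfM -[leLHS]mul1r ler_pdivrMr // => hX.
  apply: le_trans hX _; rewrite qC.
  have -> : dt * (theta * d.+1%:R * d.+2%:R) * (C * l) * (enorm (w i) * enorm (w j)) =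
    dt * theta * (d.+1%:R * d.+2%:R) * (C * (l * (enorm (w i) * enorm (w j)))) by ring.
  apply: ler_wpM2l; first by rewrite !mulr_ge0 // ltW.
  exact: ler_wpM2l.
rewrite (negbTE ij) /= addr0 !mul1r.
have e0 : 0 < d.+1%:R * d.+2%:R :> R by rewrite mulr_gt0.
have -> : volume (cell K) / (d.+1%:R * d.+2%:R) + theta * dt * (volume (cell K) * q) =
  volume (cell K) / (d.+1%:R * d.+2%:R) *
    (1 - dt * theta * (d.+1%:R * d.+2%:R) * (- q)).
  by field; rewrite -natrD nat1r !pnatr_eq0.
by rewrite pmulr_rle0 ?divr_gt0 // subr_le0.
Qed.

(** Off the diagonal the nonobtuse angles already give the sign; the upper bound on the time step is
    used for i = j. *)
Lemma cell_explicit_ge0 i j : (dt%:E <= time_step_upper Th D theta)%E ->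
  0 <= cell_mass i j - (1 - theta) * dt * cell_stiff i j.
Proof.
move=> updt.
have [c [w [phiE bv bo]]] := cell_affine basis_phi Kc.
rewrite /cell_mass (integral_phi_mul triTh Kc phiE bv bo) /cell_stiff.
rewrite !(cell_gradE triTh Kc phiE bv).
have [/andP[iK jK]|] := boolP ((i \in K) && (j \in K)); last first.
  rewrite negb_and !mul0r add0r => /orP[] /bo[_ ->].
    by rewrite bform0l !mulr0 oppr0.
  by rewrite bform0r !mulr0 oppr0.
have V0 := volume_cell_gt0 triTh Kc bv.
have symM := mean_mx_sym d_gt0 interior_closure triTh Kc bv symD intD.
have psdM := mean_mx_psd d_gt0 interior_closure triTh Kc bv posD intD.
have [theta0 theta1] := andP theta01.
have cardK : #|K| = d.+1 by case: triTh => h _ _ _ _; case: (h K Kc).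
have affK : affinely_independent a K by case: triTh => h _ _ _ _; case: (h K Kc).
have hE k kK := @heightE _ _ _ _ d_gt0 cardK affK c w bv k kK.
have qE k kK := @qvecE _ _ _ _ d_gt0 cardK affK c w bv k kK.
have e0 : 0 < d.+1%:R * d.+2%:R :> R by rewrite mulr_gt0.
have t0 : 0 <= (1 - theta) * dt * volume (cell K).
  by rewrite !mulr_ge0 ?subr_ge0 // ltW.
rewrite mulrA.
have [ij|ij] := eqVneq i j; last first.
  have [_ _] := cell_cosE iK jK ij; rewrite !qE // => q0.
  rewrite subr_ge0; apply: (@le_trans _ _ 0); first exact: mulr_ge0_le0.
  by rewrite addr0 !mul1r ltW // divr_gt0.
rewrite -{}ij; set q := bform M (w i) (w i).
have q0 : 0 <= q by exact: psdM.
have qmax : q <= eig_max M * dotv (w i) (w i) by exact: eig_max_ge.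
have n0 : 0 < enorm (w i) by apply: enorm_gt0; exact: (bary_grad_neq0 cardK bv).
(* The diagonal mass factor 1 + 1 is the 2 in the upper bound on the time step. *)
suff : (1 - theta) * dt * q <= 2 / (d.+1%:R * d.+2%:R).
  move=> h; rewrite /= mul1r -[1 + 1](natrD _ 1 1) mulrAC.
  rewrite [(_ * volume _) * q]mulrAC -mulrBl.
  by rewrite mulr_ge0 ?subr_ge0 // ltW.
have [th|th] := eqVneq theta 1.
  by rewrite th subrr !mul0r divr_ge0 // ltW.
have theta1' : theta < 1 by rewrite lt_neqAle th.
(* A nonpositive largest eigenvalue forces q = 0, and is set apart before dividing by it. *)
have [l0|l0] := leP (eig_max M) 0.
  have -> : q = 0.
    apply/eqP; rewrite eq_le q0 andbT; apply: le_trans qmax _.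
    by rewrite mulr_le0_ge0 // dotv_ge0.
  by rewrite mulr0 divr_ge0 // ltW.
have := le_time_step_upper Kc iK theta1' l0 updt.
rewrite (hE _ iK) exprVn -/(_ / _) ler_pdivlMr ?exprn_gt0 // sqr_enorm => h.
rewrite ler_pdivlMr //; apply: le_trans h.
have -> : (1 - theta) * dt * q * (d.+1%:R * d.+2%:R) =
  dt * ((1 - theta) * d.+1%:R * d.+2%:R) * q by ring.
rewrite -[leRHS]mulrA; apply: ler_wpM2l => //.
by rewrite !mulr_ge0 ?subr_ge0 // ltW.
Qed.

End element_matrices.

(* At an interior node maximizing v, row i of the scheme bounds
   v_i * (row sum of B) by (row sum of C) * M. *)
Lemma max_principle_step (R : realFieldType) (n m : nat) (B C : 'M[R]_(n + m))
    (F u v : 'cV[R]_(n + m)) (M : R) :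
  B *m v = C *m u + F ->
  (forall i j, j != lshift m i -> B (lshift m i) j <= 0) ->
  (forall i j, 0 <= C (lshift m i) j) ->
  (forall i, \sum_j B (lshift m i) j = \sum_j C (lshift m i) j) ->
  (forall i, 0 < \sum_j B (lshift m i) j) ->
  (forall i, F (lshift m i) 0 <= 0) ->
  (forall j, v (rshift n j) 0 <= M) ->
  (forall j, u j 0 <= M) ->
  forall j, v j 0 <= M.
Proof.
move=> BC Boff C0 BCsum B0 F0 vM uM j.
have [k _ kmax] := @arg_maxP _ _ _ j xpredT (fun l => v l 0) isT.
apply: le_trans (kmax j isT) _ => /=.
have [i ki|i ki] := splitP k; last first.
  by rewrite (_ : k = rshift n i) //; exact: val_inj.
have {ki}kE : k = lshift m i by exact: val_inj.
rewrite kE in kmax *; rewrite -(ler_pM2l (B0 i)).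
apply: (@le_trans _ _ ((B *m v) (lshift m i) 0)).
  (* Off-diagonal entries of [B] are nonpositive, so replacing v_l by the maximal value can only
     lower each term. *)
  rewrite mulr_suml mxE; apply: ler_sum => l _.
  have [->//|li] := eqVneq l (lshift m i).
  by rewrite ler_wnM2l ?Boff //; exact: kmax.
rewrite BC [leLHS]mxE -[leRHS]addr0 BCsum; apply: lerD; last exact: F0.
rewrite mulr_suml mxE; apply: ler_sum => l _.
exact: ler_wpM2l.
Qed.

(** * Assembled matrices, and maxima of finite element functions *)

Section scheme.
Context {R : realType} {d : nat} {Th : mesh R d} {Omega : set 'rV[R]_d}.
Variables (phi : 'I_(nint Th + nbnd Th) -> 'rV[R]_d -> R) (D : 'rV[R]_d -> 'M[R]_d).
Variables (theta dt : R).
Local Notation nvtx := (nint Th + nbnd Th)%N.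
Local Notation a := (@vertex _ _ Th).
Implicit Types (v : 'cV[R]_nvtx) (x : 'rV[R]_d).

Lemma Bmx_interior i j : Bmx phi D theta dt (lshift (nbnd Th) i) j =
  \sum_(K in cells Th)
    (cell_mass phi K (lshift _ i) j + theta * dt * cell_stiff phi D K (lshift _ i) j).
Proof.
rewrite /Bmx mxE [X in _ + X]mxE /block_mx !col_mxEu !hsubmxK !mxE.
by rewrite big_split mulr_sumr.
Qed.

Lemma Cmx_interior i j : Cmx phi D theta dt (lshift (nbnd Th) i) j =
  \sum_(K in cells Th)
    (cell_mass phi K (lshift _ i) j -
     (1 - theta) * dt * cell_stiff phi D K (lshift _ i) j).
Proof.
rewrite /Cmx mxE [X in _ + X]mxE [X in _ - X]mxE /block_mx !col_mxEu !hsubmxK !mxE.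
by rewrite sumrB mulr_sumr.
Qed.

Hypotheses (triTh : triangulation_of Th Omega) (basis_phi : nodal_basis Omega phi).

Lemma closure_cell x : closure Omega x -> exists2 K, K \in cells Th & cell K x.
Proof. by have [_ -> _ _ _] := triTh => -[K Kc xK]; exists K. Qed.

Lemma vertex_closure i : closure Omega (a i).
Proof.
have [_ -> _ [_ vK] _] := triTh; have [K Kc iK] := vK i.
by exists K => //; exact: vertex_cell.
Qed.

Lemma fe_fun_vertex v i : fe_fun phi v (a i) = v i 0.
Proof.
have phi_node j : phi j (a i) = (i == j)%:R by have [_ _ ->] := basis_phi j.
rewrite /fe_fun (bigD1 i) //= phi_node eqxx mulr1 big1 ?addr0 // => j ji.
by rewrite phi_node eq_sym (negbTE ji) mulr0.
Qed.

(** The basis functions are nonnegative with sum 1, so the value at x is a convex combination of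
    nodal values. *)
Lemma fe_fun_le v M x : closure Omega x -> (forall j, v j 0 <= M) -> fe_fun phi v x <= M.
Proof.
move=> /closure_cell[K Kc xK] vM.
have [c [w [phiE bv bo]]] := cell_affine basis_phi Kc.
rewrite -[M]mulr1 -(sum_phi triTh Kc phiE bv bo xK) mulr_sumr.
by apply: ler_sum => j _; rewrite ler_wpM2r // (phi_ge0 triTh Kc phiE bv bo).
Qed.

Lemma has_ubound_fe (u : nat -> 'cV[R]_nvtx) (S : set nat) (X : set 'rV[R]_d) N :
  S `<=` [set n | (n <= N)%N] -> X `<=` closure Omega ->
  has_ubound [set fe_fun phi (u p.1) p.2 | p in S `*` X].
Proof.
move=> SN XO; exists (\sum_(n < N.+1) \sum_j `|u n j 0|) => _ [[n x] [/= nS xX] <-].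
apply: fe_fun_le; first exact: XO.
move=> j; apply: le_trans (ler_norm _) _.
have nN : (n < N.+1)%N by rewrite ltnS; exact: SN.
rewrite (bigD1 (Ordinal nN)) //= (bigD1 j) //= -addrA lerDl addr_ge0 //.
  by apply: sumr_ge0.
by apply: sumr_ge0 => k _; apply: sumr_ge0.
Qed.

Lemma le_fe_max (u : nat -> 'cV[R]_nvtx) (S : set nat) (X : set 'rV[R]_d) N n x :
  S `<=` [set n | (n <= N)%N] -> X `<=` closure Omega -> S n -> X x ->
  fe_fun phi (u n) x <= fe_max phi u S X.
Proof.
move=> SN XO nS xX; apply: ub_le_sup; first exact: has_ubound_fe SN XO.
by exists (n, x).
Qed.

(** The condition [0 <= M] covers the empty set, whose [sup] is 0. *)
Lemma fe_max_le (u : nat -> 'cV[R]_nvtx) (S : set nat) (X : set 'rV[R]_d) M :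
  0 <= M -> (forall n x, S n -> X x -> fe_fun phi (u n) x <= M) ->
  fe_max phi u S X <= M.
Proof.
move=> M0 h; rewrite /fe_max; set E := [set _ | _ in _].
have [->|E0] := eqVneq E set0; first by rewrite sup0.
by apply: ge_sup; [exact/set0P|move=> _ [[n x] [nS xX] <-]; exact: h].
Qed.

End scheme.

(** Since [rhs] contains 0, equality can hold only when [lhs] is nonnegative; the inequality is
    unconditional. *)
Theorem theorem3p1 (R : realType) (d : nat) (Omega : set 'rV[R]_d) (T : R)
  (D : 'rV[R]_d -> 'M[R]_d) (f g : 'rV[R]_d -> R -> R) (u0 : 'rV[R]_d -> R)
  (Th : mesh R d) (phi : 'I_(nint Th + nbnd Th) -> 'rV[R]_d -> R)
  (theta dt : R) (N : nat) (u : nat -> 'cV[R]_(nint Th + nbnd Th)) :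
  (0 < d)%N ->
  polyhedral_domain Omega ->
  0 < T ->
  (forall x, Omega x -> (D x)^T = D x) ->
  (forall x, Omega x -> forall v : 'rV[R]_d, v != 0 -> 0 < bform (D x) v v) ->
  triangulation_of Th Omega ->
  nodal_basis Omega phi ->
  (forall K, K \in cells Th ->
    forall k l : 'I_d, integrable_on (cell K) (fun x => D x k l)) ->
  (forall t, 0 < t <= T -> forall K, K \in cells Th ->
    integrable_on (cell K) (fun x => f x t)) ->
  0 < theta <= 1 ->
  0 < dt ->
  (0 < N)%N ->
  N%:R * dt <= T ->
  (forall K, K \in cells Th -> forall i j, i \in K -> j \in K -> i != j ->
    0 < metric_angle D K i j <= pi / 2) ->
  (time_step_lower Th D theta <= dt%:E <= time_step_upper Th D theta)%E ->
  scheme_solution phi D f g theta dt u0 N u ->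
  (forall x t, Omega x -> 0 < t <= T -> f x t <= 0) ->
  let lhs := fe_max phi u [set n | (n <= N)%N] (closure Omega) in
  let rhs := Num.max 0
    (Num.max (fe_max phi u [set n | (1 <= n <= N)%N] (boundary Omega))
             (fe_max phi u [set 0%N] (closure Omega))) in
  lhs <= rhs /\ (0 <= lhs -> lhs = rhs).
Proof.
move=> d_gt0 [_ _ _ clO _] T0 symD posD triTh basis_phi intD intf theta01 dt0 N0 NT.
move=> angles /andP[lowdt updt] [_ sol] f0 lhs rhs.
have [theta0 theta1] := andP theta01.
pose M := rhs; have M0 : 0 <= M by rewrite /M /rhs le_max lexx.
have bclO : boundary Omega `<=` closure Omega by move=> x [].
have SN : [set n | (1 <= n <= N)%N] `<=` [set n | (n <= N)%N].
  by move=> n /= /andP[].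
have S0 : [set 0%N] `<=` [set n | (n <= N)%N] by move=> n /= ->.
(* Induction over the time levels: the initial values and all boundary values are bounded by [M] by
   definition of [rhs]. *)
have nodes n : (n <= N)%N -> forall j, u n j 0 <= M.
  elim: n => [_ j|n IH nN].
    rewrite /M /rhs !le_max -(fe_fun_vertex basis_phi).
    rewrite [X in _ || (_ || X)](le_fe_max triTh basis_phi _ S0) ?orbT //.
    exact: vertex_closure triTh j.
  apply: (max_principle_step (sol n nN)).
  - move=> i j ji; rewrite Bmx_interior; apply: sumr_le0 => K Kc.
    apply: (cell_offdiag_le0 d_gt0 clO triTh basis_phi symD posD Kc) => //.
    + exact: intD.
    + exact: angles.
    + by rewrite eq_sym.
  - move=> i j; rewrite Cmx_interior; apply: sumr_ge0 => K Kc.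
    apply: (cell_explicit_ge0 d_gt0 clO triTh basis_phi symD posD Kc) => //.
    + exact: intD.
    + exact: angles.
  (* Stiffness rows sum to 0, so both row sums reduce to that of the mass matrix. *)
  - move=> i; under eq_bigr do rewrite Bmx_interior.
    under [RHS]eq_bigr do rewrite Cmx_interior.
    rewrite exchange_big [RHS]exchange_big; apply: eq_bigr => K Kc /=.
    rewrite sumrB big_split /= -(mulr_sumr _ _ _ (theta * dt)).
    rewrite -(mulr_sumr _ _ _ ((1 - theta) * dt)).
    by rewrite (cell_stiff_sum D triTh basis_phi Kc) !mulr0 addr0 subr0.
  - move=> i; under eq_bigr do rewrite Bmx_interior.
    (* Some cell contains the node, and its diagonal mass entry makes the row sum positive. *)
    have [_ _ _ [_ vK] _] := triTh; have [L Lc iL] := vK (lshift _ i).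
    rewrite exchange_big (bigD1 L) //=.
    have rowE K : K \in cells Th -> \sum_j (cell_mass phi K (lshift _ i) j +
        theta * dt * cell_stiff phi D K (lshift _ i) j) =
        \sum_j cell_mass phi K (lshift _ i) j.
      move=> Kc; rewrite big_split /= -(mulr_sumr _ _ _ (theta * dt)).
      by rewrite (cell_stiff_sum D triTh basis_phi Kc) mulr0 addr0.
    have mass0 K j : K \in cells Th -> 0 <= cell_mass phi K (lshift _ i) j.
      by move=> Kc; exact: (cell_mass_ge0 triTh basis_phi Kc).
    apply: ltr_pwDl; last first.
      apply: sumr_ge0 => K /andP[Kc _]; rewrite rowE //.
      by apply: sumr_ge0 => j _; exact: mass0.
    rewrite rowE // (bigD1 (lshift _ i)) //=; apply: ltr_pwDl.
      exact: (cell_mass_diag_gt0 triTh basis_phi Lc).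
    by apply: sumr_ge0 => j _; exact: mass0.
  - move=> i; rewrite mxE col_mxEu mxE pmulr_rle0 //.
    apply: sumr_le0 => K Kc.
    have [c [w [phiE bv bo]]] := cell_affine basis_phi Kc.
    (* The load is sampled at a time in (0, T], as theta <= 1 and n + 1 <= N. *)
    have tT : 0 < n%:R * dt + theta * dt <= T.
      apply/andP; split.
        by rewrite ltr_wpDl ?mulr_gt0 // mulr_ge0 // ltW.
      apply: le_trans NT; rewrite -mulrDl ler_pM2r //.
      apply: (@le_trans _ _ (n%:R + 1)); first by rewrite lerD2l.
      by rewrite natr1 ler_nat.
    apply: (load_cell_le0 d_gt0 clO triTh Kc phiE bv bo
      (f := fun x => f x (n%:R * dt + theta * dt))) => [|x xO]; first exact: intf.
    exact: f0.
  - move=> j; rewrite /M /rhs !le_max -(fe_fun_vertex basis_phi).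
    rewrite [X in _ || (X || _)](le_fe_max triTh basis_phi _ SN) ?orbT //=.
    by have [_ _ _ _ [_ bd]] := triTh; exact: bd.
  - exact: IH (ltnW nN).
have lhs_le : lhs <= rhs.
  apply: fe_max_le => // n x nN xO.
  by apply: (fe_fun_le triTh basis_phi xO); exact: nodes.
(* [lhs0] handles the entry 0 of the maximum, and also the sign condition of [fe_max_le] for the
   other two entries, taken over smaller sets. *)
split => // lhs0; apply/eqP; rewrite eq_le lhs_le /= !ge_max lhs0 /=.
apply/andP; split; apply: fe_max_le => // n x nS xX;
  apply: (le_fe_max triTh basis_phi _ (fun _ h => h) (fun _ h => h)) => //.
- exact: SN.
- exact: bclO.
- exact: S0.
Qed.
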